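(* Let $U\subset\mathbb{R}^{m+n}$ be open, let $\Gamma$ be a $k$-dimensional $C^1$ submanifold of $U$ with $0\in\Gamma$, and let $V$ be an $m$-dimensional varifold in $U$ which is stationary with respect to vector fields tangent to $\Gamma$. Let $d$ be a distortion of the distance function adapted to $\Gamma$, with exponent $\alpha\in(0,1]$. Let $\varphi\in C^1_c([0,1))$ be a nonincreasing function which is constant in a neighborhood of the origin. Then there are positive constants $C$ and $\rho$ such that the following inequality holds for every positive $s<\rho$: $$\frac{d}{ds}\left[e^{Cs^\alpha}s^{-m}\int\varphi\left(\frac{d(x)}{s}\right)d\|V\|(x)\right]\ \ge\ -e^{Cs^\alpha}s^{-m}\int\varphi'\left(\frac{d(x)}{s}\right)\left|P_{\pi^\perp}\left(\frac{\nabla d(x)}{|\nabla d(x)|}\right)\right|^2dV(x,\pi).$$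
   Context: $\|V\|$ is the weight measure of the varifold $V$ and $\delta V$ its first variation, $\delta V(\chi)=\int\mathrm{div}_\pi\chi(x)\,dV(x,\pi)$. $P_\tau$ denotes the orthogonal projection onto the linear subspace $\tau$, and $\pi^\perp$ is the orthogonal complement of the $m$-plane $\pi$. The function $\varphi$ is understood to be $0$ on $[1,\infty)$. $V$ is stationary with respect to vector fields tangent to $\Gamma$ if $\delta V(\chi)=0$ for all $\chi\in C^1_c(U,\mathbb{R}^{m+n})$ which are tangent to $\Gamma$ (i.e. $\chi(x)\in T_x\Gamma$ for every $x\in\Gamma$). A function $d:\mathbb{R}^{m+n}\to\mathbb{R}$ is a distortion of the distance function adapted to $\Gamma$ (where $0\in\Gamma$), with exponent $\alpha$, if the following two conditions hold: (a) $d$ is of class $C^2$ on $\mathbb{R}^{m+n}\setminus\{0\}$ and $D^jd(x)=D^j|x|+O(|x|^{1-j+\alpha})$ for some fixed $\alpha\in(0,1]$ and for $j=0,1,2$; (b) $\nabla d$ is tangent to $\Gamma$.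
   Formalization: Added assumption: the sets {x in U : d(x) < c} shrink to the origin as c → 0 (automatic when U is a small ball about 0); without it d may vanish on a set of positive weight far from 0 and the inequality fails. *)

(* Defs.v *)
From HB Require Import structures.
From mathcomp Require Import all_boot all_order all_algebra.
From mathcomp Require Import all_classical all_reals all_analysis.

Set Implicit Arguments.
Unset Strict Implicit.
Unset Printing Implicit Defensive.

Import Order.TTheory GRing.Theory Num.Theory.
Import numFieldNormedType.Exports.

Local Open Scope classical_set_scope.
Local Open Scope ring_scope.

(* Points of R^N are row vectors 'rV[R]_N. The library norm `|x| on 'rV[R]_N is
   the sup norm: it induces the usual topology, but |x| below is [enorm x]. *)
Definition enorm (R : realType) (N : nat) (x : 'rV[R]_N) : R :=
  Num.sqrt (\sum_i x 0 i ^+ 2).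

Definition grad (R : realType) (N : nat) (f : 'rV[R]_N -> R) (x : 'rV[R]_N) :
    'rV[R]_N :=
  \row_i 'D_(delta_mx 0 i) f x.

Definition hess (R : realType) (N : nat) (f : 'rV[R]_N -> R) (x : 'rV[R]_N) :
    'M[R]_N :=
  \matrix_(i, j) 'D_(delta_mx 0 i) (fun y => 'D_(delta_mx 0 j) f y) x.

(* The set A is meant to be open, and E finite dimensional, so that continuity
   of each directional derivative amounts to continuity of the differential. *)
Definition C1_on (R : realType) (E F : normedModType R) (A : set E)
    (f : E -> F) : Prop :=
  forall x, A x ->
    differentiable f x /\ forall v, {for x, continuous (fun y => 'D_v f y)}.

Definition C2_on (R : realType) (N : nat) (A : set 'rV[R]_N)
    (f : 'rV[R]_N -> R) : Prop :=
  C1_on A f /\ C1_on A (grad f).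

(* C^1_c(U, R^N), the elements being extended by 0 outside U. *)
Definition C1c (R : realType) (N : nat) (U : set 'rV[R]_N)
    (chi : 'rV[R]_N -> 'rV[R]_N) : Prop :=
  let supp := closure [set x | chi x != 0] in
  [/\ C1_on setT chi, compact supp & supp `<=` U].

(* Embedded submanifolds, through local straightening diffeomorphisms Phi (with
   inverse Psi), which map Gam to the coordinate subspace R^k x {0}. *)
Definition C1_submanifold (R : realType) (N k : nat) (U Gam : set 'rV[R]_N) :
    Prop :=
  [/\ (k <= N)%N, Gam `<=` U &
    forall p, Gam p ->
      exists (W : set 'rV[R]_N) (Phi Psi : 'rV[R]_N -> 'rV[R]_N),
        [/\ open W /\ W p, open (Phi @` W),
            C1_on W Phi /\ C1_on (Phi @` W) Psi,
            (forall x, W x -> Psi (Phi x) = x) &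
            forall x, W x ->
              (Gam x <-> forall i : 'I_N, (k <= i)%N -> Phi x 0 i = 0)]].

(* Velocities at p of the C^1 curves contained in Gam. *)
Definition tangent_space (R : realType) (N : nat) (Gam : set 'rV[R]_N)
    (p : 'rV[R]_N) : set 'rV[R]_N :=
  [set v | exists (e : R) (gam : R -> 'rV[R]_N),
    [/\ 0 < e, C1_on (ball (0 : R) e) gam,
        (forall t, ball (0 : R) e t -> Gam (gam t)),
        gam 0 = p & 'D_1 gam 0 = v]].

Definition tangent_to (R : realType) (N : nat) (Gam : set 'rV[R]_N)
    (chi : 'rV[R]_N -> 'rV[R]_N) : Prop :=
  forall x, Gam x -> tangent_space Gam x (chi x).

(* An m-plane pi is encoded by the matrix P of the orthogonal projection onto
   it, acting on row vectors: P_pi v = v *m P and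
   P_{pi^perp} v = v *m (1%:M - P). *)
Definition Grass (R : realType) (N m : nat) : set 'M[R]_N :=
  [set P | [/\ P^T = P, P *m P = P & \rank P = m]].

Definition borel (R : realType) (E : normedModType R) : Type :=
  g_sigma_algebraType (@open E).
HB.instance Definition _ (R : realType) (E : normedModType R) :=
  Measurable.copy (borel E) (g_sigma_algebraType (@open E)).

Notation RN_Grass R N := (borel ('rV[R]_N * 'M[R]_N)%type).

(* Radon measures on U x G(m, N), extended by 0 to R^N x 'M_N. Since
   U x G(m, N) is locally compact and second countable, a Borel measure that is
   finite on compact sets is automatically regular. *)
Definition varifold (R : realType) (N m : nat) (U : set 'rV[R]_N)
    (V : {measure set (RN_Grass R N) -> \bar R}) : Prop :=
  V (~` (U `*` Grass (R := R) (N := N) m)) = 0%E /\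
  forall K : set ('rV[R]_N * 'M[R]_N)%type,
    compact K -> K `<=` U `*` Grass m -> (V K < +oo)%E.

Section weight.
Variables (R : realType) (N : nat).

Definition basepoint : RN_Grass R N -> borel 'rV[R]_N := fst.

Lemma measurable_basepoint : measurable_fun setT basepoint.
Proof.
apply: (@measurability _ _ (RN_Grass R N) (borel 'rV[R]_N) setT basepoint
          (@open 'rV[R]_N)) => //.
move=> _ [B oB <-]; apply: sub_sigma_algebra; rewrite setTI.
apply: (@open_comp ('rV[R]_N * 'M[R]_N)%type 'rV[R]_N fst) => // x _.
exact: cvg_fst.
Qed.

Variable V : {measure set (RN_Grass R N) -> \bar R}.

(* The weight measure ||V||. *)
Definition weight : set (borel 'rV[R]_N) -> \bar R := pushforward V basepoint.

Let weight0 : weight set0 = 0%E.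
Proof. by rewrite /weight /pushforward preimage_set0 measure0. Qed.

Let weight_ge0 A : (0 <= weight A)%E.
Proof. by rewrite /weight /pushforward; exact: measure_ge0. Qed.

Let weight_sigma_additive : semi_sigma_additive weight.
Proof.
move=> F mF tF mUF; rewrite /weight /pushforward preimage_bigcup.
have mfst A : measurable A ->
    measurable (basepoint @^-1` A).
  by move=> mA; rewrite -[X in measurable X]setTI; exact: measurable_basepoint.
apply: measure_semi_sigma_additive => [n| |]; first exact: mfst.
- apply/trivIsetP => i j _ _ ij; rewrite -preimage_setI.
  by move/trivIsetP : tF => /(_ _ _ _ _ ij) ->//; rewrite preimage_set0.
- by rewrite -preimage_bigcup; exact: mfst.
Qed.

HB.instance Definition _ := isMeasure.Build _ _ _ weight
  weight0 weight_ge0 weight_sigma_additive.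

End weight.

(* div_pi chi (x) = tr (D chi(x) o P_pi): with row vectors, the linear map
   v |-> D chi(x) (P_pi v) has matrix P *m 'J chi x. The measure V is carried by
   U x G(m, N), so it is integrated over the whole space. *)
Definition first_variation (R : realType) (N : nat)
    (V : {measure set (RN_Grass R N) -> \bar R})
    (chi : 'rV[R]_N -> 'rV[R]_N) : R :=
  \int[V]_z (\tr (z.2 *m 'J chi z.1)).

Definition stationary_tangent (R : realType) (N : nat)
    (U Gam : set 'rV[R]_N) (V : {measure set (RN_Grass R N) -> \bar R}) : Prop :=
  forall chi, C1c U chi -> tangent_to Gam chi -> first_variation V chi = 0.

(* The expansions are as x --> 0. The one of order j = 0 includes x = 0, i.e.
   d 0 = 0; the derivatives of d and of |x| exist only for x != 0. *)
Definition distortion (R : realType) (N : nat) (Gam : set 'rV[R]_N)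
    (alpha : R) (d : 'rV[R]_N -> R) : Prop :=
  let r (a : R) := (fun x : 'rV[R]_N => enorm x `^ a) : 'rV[R]_N -> R in
  [/\ 0 < alpha <= 1,
      C2_on [set x | x != 0] d,
      [/\ (fun x => d x - enorm x) =O_ (0 : 'rV[R]_N) r (1 + alpha),
          (fun x => grad d x - grad (@enorm R N) x)
            =O_ ((0 : 'rV[R]_N)^') r alpha &
          (fun x => hess d x - hess (@enorm R N) x)
            =O_ ((0 : 'rV[R]_N)^') r (alpha - 1)] &
      forall x, Gam x -> x != 0 -> tangent_space Gam x (grad d x)].

(* Nonincreasing phi in C^1_c([0, 1)), constant near the origin and 0 on [1, +oo[.
   As a function on R, phi is also taken constant on a two-sided neighborhood
   of 0, so that its derivative at the endpoint 0 of [0, 1) is the two-sided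
   one; its other values on negative numbers are irrelevant. *)
Definition cutoff (R : realType) (phi : R -> R) : Prop :=
  [/\ (forall t, 0 < t < 1 ->
         derivable phi t 1 /\ {for t, continuous (derive1 phi)}),
      (exists2 c, 0 <= c < 1 & forall t, c <= t -> phi t = 0),
      (forall t u, 0 <= t -> t <= u -> u < 1 -> phi u <= phi t) &
      \forall t \near (0 : R), phi t = phi 0].

(* The sublevel sets {x in U | d x < c} shrink to the origin as c decreases to 0.
   By [distortion], this holds as soon as U is a small enough ball around 0.
   [distortion] says nothing about d away from the origin, so without this
   property d might vanish on a set of positive weight far from 0 (or phi be
   evaluated at negative numbers), and monotonicity fails. *)
Definition sublevels_shrink (R : realType) (N : nat) (U : set 'rV[R]_N)
    (d : 'rV[R]_N -> R) : Prop :=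
  forall r, 0 < r ->
    exists2 c, 0 < c & forall x, U x -> d x < c -> enorm x < r.

(* Main.v *)
(* Test stationarity with chi = phi(d/s) grad(d^2/2). Near the origin the
   differential of grad(d^2/2) = d grad d is the identity up to O(|x|^alpha), so
   chi is C^1 across the origin and, with q = d/s and p = |P_perp nu|^2,
   nu = grad d / |grad d|,
     div_pi chi = phi'(q) q |grad d|^2 (1 - p) + phi(q) (m + O(s^alpha)).
   Differentiating s^-m int phi(d/s) under the integral sign produces
   - phi'(q) q - m phi(q). Adding the multiple (1 - O(s^alpha)) of the vanishing
   first variation leaves - phi'(q) q p up to an error O(s^alpha) phi(q), which
   the factor exp(C s^alpha) absorbs. Finally q/s >= 1 on the support of phi'(q)
   once s is small, because phi is constant near 0. *)
Require Import Defs.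
From HB Require Import structures.
From mathcomp Require Import all_boot all_order all_algebra.
From mathcomp Require Import all_classical all_reals all_analysis.
From mathcomp Require Import measurable_realfun ring lra.

Set Implicit Arguments.
Unset Strict Implicit.
Unset Printing Implicit Defensive.

Import Order.TTheory GRing.Theory Num.Theory.
Import numFieldNormedType.Exports.

Local Open Scope classical_set_scope.
Local Open Scope ring_scope.

(** * Compactness of the Grassmannian, integration against a varifold *)

(** The comparison is made for each pair (x, pi) separately: the combination of integrands in
    [integrand_ge0] is nonnegative pointwise. Integrals then enter only through linearity,
    differentiation under the integral sign and the vanishing of the first variation.

    Two obstacles shape the rest. The varifold may have infinite mass on U x G(m, N), so every
    integrand has to be confined to a compact set: over U it vanishes off a closed ball around 0,
    and the Grassmannian is compact. The two radii r and r / 2 serve this: the expansions of d hold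
    for [|x| < r], while the part of U where d < c lies in the ball of radius r / 2. The collar in
    between lets the test field be cut off without loss of smoothness.

    The second obstacle is the origin, where d need not be differentiable and the direction of its
    gradient has no limit. The terms with phi' vanish near 0. The term phi(q) does not, and there
    the expansions of d must show both that d grad d is differentiable at 0 with the identity as
    differential and that this differential is continuous at 0. *)

Lemma continuous_at_sum (K : numFieldType) (V : normedModType K)
    (T : topologicalType) (I : Type) (r : seq I) (P : pred I) (f : I -> T -> V)
    (t : T) : (forall i, P i -> {for t, continuous (f i)}) ->
  {for t, continuous (fun x => \sum_(i <- r | P i) f i x)}.
Proof.
move=> fl; apply: (@cvg_big _ _ +%R 0 P _ _ _ r f (f^~ t)) => //.
exact: add_continuous.
Qed.

Lemma cvg_mx_entries (R : realFieldType) (T : Type) (F : set_system T)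
    {FF : Filter F} (m n : nat) (f : T -> 'M[R]_(m, n)) (l : 'M[R]_(m, n)) :
  (forall i j, f x i j @[x --> F] --> l i j) -> f @ F --> l.
Proof.
move=> fl; apply/cvgrPdist_le => /= e e0.
near=> x.
rewrite /Num.Def.normr/= mx_normrE (bigmax_le _ (ltW e0))//= => i _.
rewrite !mxE/=.
move: i; near: x; apply: filter_forall => /= i.
exact: ((cvgrPdist_le _ _).1 (fl i.1 i.2)).
Unshelve. all: by end_near. Qed.

Lemma mx_entry_norm_le (R : realFieldType) (m n : nat) (A : 'M[R]_(m, n)) i j :
  `|A i j| <= `|A|.
Proof.
rewrite [leRHS]/Num.Def.normr/= mx_normrE.
exact: (le_bigmax _ (fun ij : 'I_m * 'I_n => `|A ij.1 ij.2|) (i, j)).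
Qed.

(** Write P = X Y with X of full column rank and Y of full row rank. Cancelling X on the left and Y
    on the right in P P = P leaves Y X = 1, and tr (X Y) = tr (Y X). *)
Lemma mxtrace_idempotent (F : fieldType) (n : nat) (P : 'M[F]_n) :
  P *m P = P -> \tr P = (\rank P)%:R.
Proof.
move=> PP; rewrite -{1}(mulmx_base P) mxtrace_mulC.
suff -> : row_base P *m col_base P = 1%:M by rewrite mxtrace1.
have /row_freeP[B rB] := row_base_free P.
have [A Ac] : exists A, A *m col_base P = 1%:M.
  by apply/row_fullP; exact: col_base_full.
have := PP; rewrite -{1 2 3}(mulmx_base P).
move: (col_base P) (row_base P) rB Ac => X Y YB AX.
move/(congr1 (fun M => A *m M *m B)).
by rewrite /= !mulmxA AX !mul1mx -!mulmxA YB !mulmx1.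
Qed.

(** By P = P P^T, a diagonal entry is the sum of the squares of its row. Hence P_kl^2 <= P_kk, and
    the case k = l forces P_kk <= 1. *)
Lemma orthoproj_entry_le1 (R : realFieldType) (n : nat) (P : 'M[R]_n) i j :
  P^T = P -> P *m P = P -> `|P i j| <= 1.
Proof.
move=> PT PP.
have sym k l : P l k = P k l by rewrite -[in LHS]PT mxE.
have diagE k : P k k = \sum_l P k l ^+ 2.
  by rewrite -[in LHS]PP mxE; apply: eq_bigr => l _; rewrite sym expr2.
have key k l : P k l ^+ 2 <= P k k.
  rewrite diagE (bigD1 l)//= lerDl sumr_ge0// => h _.
  exact: sqr_ge0.
have P1 : P i i <= 1.
  have := key i i; have := sqr_ge0 (P i i); nra.
rewrite -(@expr_le1 _ 2)// real_normK ?num_real//.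
exact: le_trans (key i j) P1.
Qed.

Lemma Grass_compact (R : realType) (N m : nat) : compact (Grass (R := R) (N := N) m).
Proof.
have K1 : compact [set v : 'rV[R]_(N * N)%N | forall i, v ord0 i \in `[(-1), 1]].
  by apply: (@rV_compact R _ (fun=> `[(-1), 1]%classic)) => _; exact: segment_compact.
have vc : continuous (vec_mx : 'rV[R]_(N * N)%N -> 'M[R]_N).
  move=> v; apply: (@cvg_mx_entries R _ (nbhs v)) => i j.
  under eq_fun do rewrite mxE.
  by rewrite mxE; exact: coord_continuous.
have K2 := continuous_compact (continuous_subspaceT vc) K1.
apply: subclosed_compact K2 _; last first.
  move=> P [PT PP _]; exists (mxvec P); last by rewrite mxvecK.
  move=> k; case/mxvec_indexP: k => i j; rewrite mxvecE in_itv/= -ler_norml.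
  exact: orthoproj_entry_le1.
(* The condition on the rank is not closed by itself. On idempotents it is equivalent to the
   polynomial condition that the trace be m, so [Grass m] is a zero set of continuous functions. *)
have -> : Grass m = \bigcap_(ij in [set: 'I_N * 'I_N])
    ([set P : 'M[R]_N | P ij.2 ij.1 - P ij.1 ij.2 = 0] `&`
     [set P : 'M[R]_N | \sum_k P ij.1 k * P k ij.2 - P ij.1 ij.2 = 0]) `&`
    [set P : 'M[R]_N | \sum_k P k k - m%:R = 0].
  apply/seteqP; split => P /=.
    move=> [PT PP rP]; split.
      move=> [i j] _ /=; split; first by rewrite -[in X in X - _]PT mxE subrr.
      by rewrite -[in X in _ - X]PP mxE subrr.
    by rewrite -/(mxtrace P) mxtrace_idempotent// rP subrr.
  move=> [/= PTP]; rewrite -/(mxtrace P) => /eqP; rewrite subr_eq0 => /eqP trP.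
  have PP : P *m P = P.
    apply/matrixP => i j; rewrite mxE.
    by have [_ /eqP] := PTP (i, j) I; rewrite subr_eq0 => /eqP.
  split => //.
    apply/matrixP => i j; rewrite mxE.
    by have [/eqP] := PTP (i, j) I; rewrite subr_eq0 => /eqP.
  by move: trP; rewrite mxtrace_idempotent// => /eqP; rewrite eqr_nat => /eqP.
have cl (f : 'M[R]_N -> R) : continuous f -> closed [set P | f P = 0].
  move=> cf; apply: (@preimage_closed _ _ f [set 0]); last exact: closed_eq.
  by move=> x _; exact: cf.
have cc i j (P : 'M[R]_N) : {for P, continuous (fun Q : 'M[R]_N => Q i j)}.
  exact: coord_continuous.
apply: closedI.
  apply: closed_bigI => -[i j] _ /=; apply: closedI; apply: cl => P.
    exact: (continuousB (cc j i P) (cc i j P)).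
  apply: (@continuousB _ _ _ (fun Q : 'M[R]_N => \sum_(k < N) Q i k * Q k j)) => //.
  apply: continuous_at_sum => k _.
  exact: (continuousM (cc i k P) (cc k j P)).
apply: cl => P.
apply: (@continuousB _ _ _ (fun Q : 'M[R]_N => \sum_(k < N) Q k k)); last exact: cst_continuous.
by apply: continuous_at_sum => k _; exact: cc.
Qed.

(** * Measurability and integrals over U times the Grassmannian *)

Lemma borel_measurable_open (R : realType) (E : normedModType R) (A : set E) :
  open A -> measurable (A : set (borel E)).
Proof. by move=> oA; exact: sub_sigma_algebra. Qed.

Lemma borel_measurable_closed (R : realType) (E : normedModType R) (A : set E) :
  closed A -> measurable (A : set (borel E)).
Proof.
move=> cA; rewrite -[A]setCK; apply: measurableC.
by apply: borel_measurable_open; exact: closed_openC.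
Qed.

Lemma borel_continuous_measurable (R : realType) (E : normedModType R)
    (A : set E) (f : E -> R) :
  open A -> (forall x, A x -> {for x, continuous f}) ->
  measurable_fun (A : set (borel E)) (f : borel E -> R).
Proof.
move=> oA cf; apply: (measurability _ (RGenOpens.measurableE R)) => _ [_ [a [b ->] <-]].
apply: (@borel_measurable_open R E).
suff : open (A `&` f @^-1` `]a, b[%classic : set E) by [].
rewrite openE => x [Ax /= fx]; apply: filterI; first exact: open_nbhs_nbhs.
by apply: (cf x Ax); apply: open_nbhs_nbhs; split => //; exact: interval_open.
Qed.

Lemma measurable_varifold_domain (R : realType) (N m : nat) (U : set 'rV[R]_N) :
  open U -> measurable (U `*` Grass m : set (RN_Grass R N)).
Proof.
move=> oU; have -> : U `*` Grass m =
    (fst @^-1` U : set ('rV[R]_N * 'M[R]_N)%type) `&` snd @^-1` Grass m by [].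
apply: (@measurableI _ (RN_Grass R N)).
  apply: borel_measurable_open.
  by apply: open_comp => // x _; exact: cvg_fst.
apply: borel_measurable_closed; apply: preimage_closed.
  by move=> x _; exact: cvg_snd.
by apply: compact_closed; [exact: norm_hausdorff|exact: Grass_compact].
Qed.

Section varifold_integral.
Variables (R : realType) (N m : nat) (U : set 'rV[R]_N).
Variable V : {measure set (RN_Grass R N) -> \bar R}.
Hypotheses (oU : open U) (varV : varifold m U V).

Let D : set (RN_Grass R N) := U `*` Grass m.

(** On [K] times the Grassmannian, a compact set of finite measure, f is bounded by continuity.
    Continuity is asked over [U] alone because d may be negative elsewhere, where nothing controls
    phi. *)
Lemma varifold_integrable (K : set 'rV[R]_N) (f : 'rV[R]_N * 'M[R]_N -> R) :
  compact K -> K `<=` U ->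
  (forall z, U z.1 -> {for z, continuous f}) ->
  (forall z, U z.1 -> ~ K z.1 -> f z = 0) ->
  V.-integrable D (EFin \o (f : RN_Grass R N -> R)).
Proof.
move=> cK KU cf f0.
pose KG : set (RN_Grass R N) := K `*` Grass m.
have cKG : compact (KG : set ('rV[R]_N * 'M[R]_N)%type).
  by apply: compact_setX => //; exact: Grass_compact.
have mKG : measurable KG.
  by apply: borel_measurable_closed; apply: compact_closed => //; exact: norm_hausdorff.
have mD : measurable D := measurable_varifold_domain m oU.
have KGD : KG `<=` D by move=> z [Kz Gz]; split => //; exact: KU.
suff intK : V.-integrable KG (EFin \o (f : RN_Grass R N -> R)).
  apply/(integrable_mkcond _ mD).
  have -> : (EFin \o (f : RN_Grass R N -> R)) \_ D =
      (EFin \o (f : RN_Grass R N -> R)) \_ KG.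
    apply/funext => z; rewrite /patch.
    case: ifPn => [/set_mem Dz|/negP nDz]; case: ifPn => [/set_mem Kz|/negP nKz]//.
      rewrite /= f0//; first by case: Dz.
      by move=> Kz; apply: nKz; apply/mem_set; split => //; case: Dz.
    by exfalso; apply: nDz; apply/mem_set; exact: KGD.
  exact/(integrable_mkcond _ mKG).
apply: measurable_bounded_integrable => //.
- by have [_] := varV; apply => // z [/= Kz Gz]; split => //; exact: KU.
- apply: (@measurable_funS _ _ _ _ (fst @^-1` U : set (RN_Grass R N))).
  + by apply: borel_measurable_open; apply: open_comp => // x _; exact: cvg_fst.
  + by move=> z [Kz _]; exact: KU.
  + by apply: borel_continuous_measurable => //; apply: open_comp => // x _; exact: cvg_fst.
have : compact (f @` KG).
  apply: continuous_compact => //.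
  by apply: continuous_in_subspaceT => z /set_mem [Kz _]; apply: cf; exact: KU.
move/compact_bounded => [M [Mr fM]]; exists M; split => // x Mx z KGz /=.
by apply: (fM x Mx); exists z.
Qed.

(** Supplies the dominating function for differentiation under the integral; an indicator is not
    continuous, so it escapes the preceding lemma. *)
Lemma varifold_integrable_cst (K : set 'rV[R]_N) (M : R) :
  compact K -> K `<=` U ->
  V.-integrable D (EFin \o (fun z : RN_Grass R N => M * \1_K (z.1 : 'rV[R]_N))).
Proof.
move=> cK KU.
pose KG : set (RN_Grass R N) := K `*` Grass m.
have cKG : compact (KG : set ('rV[R]_N * 'M[R]_N)%type).
  by apply: compact_setX => //; exact: Grass_compact.
have mKG : measurable KG.
  by apply: borel_measurable_closed; apply: compact_closed => //; exact: norm_hausdorff.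
have mD : measurable D := measurable_varifold_domain m oU.
have KGD : KG `<=` D by move=> z [Kz Gz]; split => //; exact: KU.
apply/(integrable_mkcond _ mD).
have -> : (EFin \o (fun z : RN_Grass R N => M * \1_K (z.1 : 'rV[R]_N))) \_ D =
    (EFin \o cst M) \_ KG.
  apply/funext => z; rewrite /patch /= indicE.
  case: ifPn => [/set_mem [/= Uz Gz]|/negP nDz]; case: ifPn => [/set_mem [/= Kz Gz']|/negP nKz]//=.
  - by rewrite mem_set// mulr1.
  - rewrite memNset ?mulr0// => Kz.
    by apply: nKz; apply/mem_set.
  - by exfalso; apply: nDz; apply/mem_set; apply: KGD.
apply/(integrable_mkcond _ mKG).
apply: measurable_bounded_integrable => //.
- by have [_] := varV; apply => // z [/= Kz Gz]; split => //; exact: KU.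
- exact: bounded_cst.
Qed.

(** Bridges [first_variation], an integral over the whole space, and the integrals over [D]: the
    complement of [D] is a null set, and global continuity makes f measurable there too. *)
Lemma varifold_Rintegral_setT (K : set 'rV[R]_N) (f : 'rV[R]_N * 'M[R]_N -> R) :
  compact K -> K `<=` U -> continuous f ->
  (forall z, U z.1 -> ~ K z.1 -> f z = 0) ->
  \int[V]_z (f : RN_Grass R N -> R) z = \int[V]_(z in D) (f : RN_Grass R N -> R) z.
Proof.
move=> cK KU cf f0.
have mD : measurable D := measurable_varifold_domain m oU.
have iD : V.-integrable D (EFin \o (f : RN_Grass R N -> R)).
  by apply: (varifold_integrable cK) => // z _; exact: cf.
have V0 : V (~` D) = 0%E by have [] := varV.
have mND : measurable (~` D) by exact: measurableC.
have DE : D = setT `\` ~` D by rewrite setTD setCK.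
rewrite /Rintegral (negligible_integral mND)// -?DE//.
apply/(negligible_integrable mND) => //; last by rewrite -DE.
apply/measurable_EFinP.
apply: (@borel_continuous_measurable _ _ setT) => [|z _]; first exact: openT.
exact: cf.
Qed.

Lemma weight_Rintegral (f : 'rV[R]_N -> R) :
  (forall x, U x -> {for x, continuous f}) -> (forall x, U x -> 0 <= f x) ->
  \int[weight V]_(x in U) (f : borel 'rV[R]_N -> R) x =
  \int[V]_(z in D) (f : borel 'rV[R]_N -> R) (basepoint z).
Proof.
move=> cf f0; rewrite /Rintegral; congr fine.
have mD : measurable D := measurable_varifold_domain m oU.
have mU : measurable (U : set (borel 'rV[R]_N)) by exact: borel_measurable_open.
have mf : measurable_fun (U : set (borel 'rV[R]_N)) (f : borel 'rV[R]_N -> R).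
  exact: borel_continuous_measurable.
rewrite (@ge0_integral_pushforward _ _ _ _ _ _ (@measurable_basepoint R N) V U
  (fun x => ((f : borel 'rV[R]_N -> R) x)%:E))//; last 2 first.
- exact/measurable_EFinP.
- by move=> x /set_mem Ux; rewrite lee_fin; exact: f0.
have V0 : V (~` D) = 0%E by have [] := varV.
have mND : measurable (~` D) by exact: measurableC.
have mpU : measurable (@basepoint R N @^-1` U).
  by rewrite -[X in measurable X]setTI; exact: measurable_basepoint.
rewrite (ge0_negligible_integral mND)//; last 2 first.
- apply/measurable_EFinP.
  apply: (measurable_comp mU) => //; first by move=> _ [z Uz <-].
  by apply: measurable_funTS; exact: measurable_basepoint.
- by move=> z Uz /=; rewrite lee_fin; exact: f0.
congr integral.
apply/seteqP; split => [z [Uz /contrapT]//|z Dz].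
by split => //; case: Dz.
Qed.

End varifold_integral.

(** * Functions of class C^1 *)

(** Serves both to transfer differentiability between functions that agree near a point and to
    differentiate the test field at the origin, where no product rule is available. *)
Lemma littleo_is_diff0 (R : numFieldType) (V W : normedModType R) (f : V -> W)
    (x : V) :
  f x = 0 ->
  (forall e, 0 < e -> \forall y \near x, `|f y| <= e * `|y - x|) ->
  is_diff x f 0.
Proof.
move=> fx0 fo.
have H : f \o shift x = cst (f x) + (\0 : V -> W) +o_ 0 id.
  apply/eqaddoP => e e0.
  have := fo _ e0; rewrite (near_shift 0 x) subr0.
  apply: filterS => y /=; rewrite addrK => fy.
  by rewrite !fctE/= fx0 addr0 subr0.
have c0 : continuous (\0 : V -> W) by exact: cst_continuous.
have d0 : 'd f x = \0 :> (V -> W) by exact: diff_unique.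
apply: DiffDef; last by rewrite d0.
by apply/diff_locallyP; rewrite d0.
Qed.

Lemma near_eq_differentiable (R : numFieldType) (V W : normedModType R)
    (f g : V -> W) (x : V) :
  {near x, f =1 g} -> differentiable f x -> differentiable g x.
Proof.
move=> fg df; rewrite (_ : g = f + (g - f)); last by apply/funext => y; rewrite !fctE addrC subrK.
apply: differentiableD => //.
have : is_diff x (g - f) 0.
  apply: littleo_is_diff0.
    by rewrite !fctE (nbhs_singleton fg) subrr.
  move=> e e0; apply: filterS fg => y fgy.
  by rewrite !fctE fgy subrr normr0 mulr_ge0// ltW.
by move=> [].
Qed.

Lemma differentiable_row (R : realFieldType) (V : normedModType R) (n : nat)
    (f : V -> 'rV[R]_n) (x : V) :
  (forall j, differentiable (fun y => f y 0 j) x) -> differentiable f x.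
Proof.
move=> fx.
have -> : f = \sum_(j < n) (fun y => f y 0 j *: (delta_mx 0 j : 'rV[R]_n)).
  by apply/funext => y; rewrite fct_sumE -row_sum_delta.
by apply: differentiable_sum => j; exact: differentiableZl.
Qed.

Lemma derive_comp1 (R : realFieldType) (E : normedModType R) (f : E -> R)
    (g : R -> R) (x v : E) :
  differentiable f x -> derivable g (f x) 1 ->
  'D_v (g \o f) x = derive1 g (f x) * 'D_v f x.
Proof.
move=> df /derivable1_diffP dg.
rewrite deriveE; last exact: differentiable_comp.
rewrite diff_comp//= [in RHS]deriveE// derive1E' //.
by rewrite -[X in 'd g _ X]mulr1 [LHS]linearZ mulrC.
Qed.

Lemma near_eq_continuous (T U : topologicalType) (f g : T -> U) (x : T) :
  {near x, f =1 g} -> {for x, continuous f} -> {for x, continuous g}.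
Proof.
move=> fg; rewrite /prop_for/continuous_at -(nbhs_singleton fg).
by apply: cvg_trans; exact: near_eq_cvg.
Qed.

Section C1.
Variables (R : realType) (E : normedModType R).
Implicit Types (A : set E) (f g : E -> R).

Lemma near_eq_C1 (F : normedModType R) (f g : E -> F) x :
  {near x, f =1 g} -> C1_on [set x] f -> C1_on [set x] g.
Proof.
move=> fg fC _ ->; have [df cf] := fC x erefl.
split; first exact: near_eq_differentiable df.
(* Continuity of the derivative at x needs the two derivatives to agree around x, not only at x; f
   and g agree near each interior point of the neighborhood. *)
move=> v; have e : {near x, 'D_v f =1 'D_v g}.
  have /nbhs_interior := fg; apply: filterS => y fgy.
  exact: near_eq_derive.
apply: (near_eq_continuous e); exact: cf.
Qed.

Lemma C1_on_row A (n : nat) (f : E -> 'rV[R]_n) : open A ->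
  C1_on A f <-> forall j, C1_on A (fun x => f x 0 j).
Proof.
move=> oA; split => [fC j x Ax|fC x Ax].
  have dj y : A y -> differentiable (fun x => f x 0 j) y.
    move=> Ay; apply: (@differentiable_comp _ _ _ _ f (fun M : 'rV[R]_n => M 0 j)).
      by have [] := fC y Ay.
    exact: differentiable_coord.
  split; first exact: dj.
  move=> v.
  have e : {near x, (fun y => 'D_v f y 0 j) =1 'D_v (fun x => f x 0 j)}.
    have : nbhs x A by exact: open_nbhs_nbhs.
    apply: filterS => y Ay; rewrite derive_mx ?mxE//.
    by apply: diff_derivable; have [] := fC y Ay.
  apply: (near_eq_continuous e).
  have [_ /(_ v) cf] := fC x Ax.
  apply: (@continuous_comp _ _ _ ('D_v f) (fun M : 'rV[R]_n => M 0 j)) => //.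
  exact: coord_continuous.
have df y : A y -> differentiable f y.
  by move=> Ay; apply: differentiable_row => j; have [] := fC j y Ay.
split; first exact: df.
move=> v.
have e : {near x, (fun y => \row_j 'D_v (fun x => f x 0 j) y) =1 'D_v f}.
  have : nbhs x A by exact: open_nbhs_nbhs.
  apply: filterS => y Ay; rewrite derive_mx.
    by apply/rowP => j; rewrite !mxE.
  by apply: diff_derivable; exact: df.
apply: (near_eq_continuous e).
apply: (@cvg_mx_entries _ _ (nbhs x)) => i j; rewrite !mxE.
rewrite (_ : (fun y => _) = 'D_v (fun x => f x 0 j)).
  by have [_] := fC j x Ax; exact.
by apply/funext => y; rewrite mxE.
Qed.

Lemma C1_onM A f g : open A -> C1_on A f -> C1_on A g ->
  C1_on A (fun x => f x * g x).
Proof.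
move=> oA fC gC x Ax.
have [df cf] := fC x Ax; have [dg cg] := gC x Ax.
split; first exact: (differentiableM df dg).
move=> v.
have e : {near x, (fun y => f y * 'D_v g y + g y * 'D_v f y)
    =1 'D_v (fun x => f x * g x)}.
  have : nbhs x A by exact: open_nbhs_nbhs.
  apply: filterS => y Ay.
  by rewrite (deriveM (diff_derivable (fC y Ay).1) (diff_derivable (gC y Ay).1)).
apply: (near_eq_continuous e).
apply: (@continuousD _ _ _ (fun y => f y * 'D_v g y)); apply: continuousM => //;
  exact: differentiable_continuous.
Qed.

Lemma C1_on_comp A f (h : R -> R) : open A -> C1_on A f ->
  (forall x, A x -> derivable h (f x) 1 /\ {for f x, continuous (derive1 h)}) ->
  C1_on A (h \o f).
Proof.
move=> oA fC hC x Ax.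
have [df cf] := fC x Ax; have [dh ch] := hC x Ax.
have /derivable1_diffP dh' := dh.
split; first exact: (differentiable_comp df dh').
move=> v.
have e : {near x, (fun y => derive1 h (f y) * 'D_v f y) =1 'D_v (h \o f)}.
  have : nbhs x A by exact: open_nbhs_nbhs.
  by apply: filterS => y Ay; rewrite (derive_comp1 v (fC y Ay).1 (hC y Ay).1).
apply: (near_eq_continuous e).
have ch' : {for x, continuous (fun y => derive1 h (f y))}.
  exact: (continuous_comp (differentiable_continuous df) ch).
exact: (continuousM ch' (cf v)).
Qed.

End C1.

(** * The Euclidean norm and its distortions *)

Lemma open_ne0 (R : realType) (E : normedModType R) : open [set x : E | x != 0].
Proof.
rewrite (_ : [set _ | _] = ~` [set 0]); last first.
  by apply/seteqP; split => x /eqP.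
by apply/closed_openC/accessible_closed_set1/hausdorff_accessible/norm_hausdorff.
Qed.

Section enorm.
Variables (R : realType) (N : nat).
Implicit Types x : 'rV[R]_N.

Lemma enorm_ge0 x : 0 <= enorm x.
Proof. exact: sqrtr_ge0. Qed.

Lemma enorm_sqr x : enorm x ^+ 2 = \sum_i x 0 i ^+ 2.
Proof. by rewrite sqr_sqrtr// sumr_ge0// => i _; rewrite sqr_ge0. Qed.

Lemma entry_le_enorm x i : `|x 0 i| <= enorm x.
Proof.
rewrite -ler_sqr ?nnegrE ?enorm_ge0// real_normK ?num_real// enorm_sqr.
by rewrite (bigD1 i)//= lerDl sumr_ge0// => j _; rewrite sqr_ge0.
Qed.

Lemma norm_le_enorm x : `|x| <= enorm x.
Proof.
rewrite [leLHS]/Num.Def.normr/= mx_normrE (bigmax_le _ (enorm_ge0 x))//=.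
by move=> [i j] _ /=; rewrite ord1 entry_le_enorm.
Qed.

Lemma enorm_le_norm x : enorm x <= N%:R * `|x|.
Proof.
rewrite -ler_sqr ?nnegrE ?enorm_ge0 ?mulr_ge0// enorm_sqr exprMn.
apply: (@le_trans _ _ (\sum_(i < N) `|x| ^+ 2)).
  apply: ler_sum => i _; rewrite -[leLHS]real_normK ?num_real//.
  by rewrite ler_sqr ?nnegrE// mx_entry_norm_le.
rewrite sumr_const card_ord -[leLHS]mulr_natl ler_wpM2r ?sqr_ge0//.
by rewrite -natrX ler_nat; case: (N) => // n; rewrite leq_pmulr.
Qed.

Lemma enorm0 : enorm (0 : 'rV[R]_N) = 0.
Proof. by apply/le_anti; rewrite enorm_ge0 andbT (le_trans (enorm_le_norm _))// normr0 mulr0. Qed.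

Lemma enorm_eq0 x : (enorm x == 0) = (x == 0).
Proof.
apply/eqP/eqP => [x0|->]; last exact: enorm0.
by apply/eqP; rewrite -normr_le0 -x0 norm_le_enorm.
Qed.

Lemma enorm_gt0 x : (0 < enorm x) = (x != 0).
Proof. by rewrite lt_def enorm_eq0 enorm_ge0 andbT. Qed.

Lemma enorm_near0 (e : R) : 0 < e -> \forall x \near (0 : 'rV[R]_N), enorm x < e.
Proof.
move=> e0; near=> x; apply: (le_lt_trans (enorm_le_norm x)).
(* [N.+1] instead of [N] keeps the factor invertible when N = 0. *)
apply: (@le_lt_trans _ _ (N.+1%:R * `|x|)); first by rewrite ler_wpM2r// ler_nat.
rewrite -ltr_pdivlMl//; near: x; apply: (@nbhs0_lt R 'rV[R]_N).
by rewrite mulr_gt0// invr_gt0.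
Unshelve. all: by end_near. Qed.

(** The squared norm is a polynomial, so the derivative of [enorm] off 0 follows from the chain rule
    for the square root. *)
Let q x : R := \sum_i x 0 i ^+ 2.

Let qE : q = \sum_i (fun y : 'rV[R]_N => y 0 i * y 0 i).
Proof. by apply/funext => y; rewrite fct_sumE; apply: eq_bigr => i _. Qed.

Let differentiable_q x : differentiable q x.
Proof.
rewrite qE; apply: differentiable_sum => i.
exact: (differentiableM (differentiable_coord _ 0 i) (differentiable_coord _ 0 i)).
Qed.

Lemma derive_coord x v i : 'D_v (fun y : 'rV[R]_N => y 0 i) x = v 0 i.
Proof.
have dx : derivable (id : 'rV[R]_N -> 'rV[R]_N) x v by exact: derivable_id.
have := derive_mx dx.
by rewrite derive_id => /(congr1 (fun M : 'rV[R]_N => M 0 i)); rewrite mxE.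
Qed.

Let derive_q x v : 'D_v q x = 2 * \sum_i x 0 i * v 0 i.
Proof.
have dc i : derivable (fun y : 'rV[R]_N => y 0 i) x v.
  by apply: diff_derivable; exact: differentiable_coord.
rewrite qE derive_sum => [|i]; last exact: (derivableM (dc i) (dc i)).
rewrite mulr_sumr; apply: eq_bigr => i _.
rewrite (deriveM (dc i) (dc i)) derive_coord /GRing.scale/=.
by ring.
Qed.

Let q_gt0 x : x != 0 -> 0 < q x.
Proof. by rewrite -enorm_gt0 /enorm sqrtr_gt0. Qed.

Lemma differentiable_enorm x : x != 0 -> differentiable (@enorm R N) x.
Proof.
move=> /q_gt0 qx.
have ds : differentiable (@Num.sqrt R) (q x).
  have [/derivable1_diffP] := is_derive1_sqrt qx; exact.
exact: (differentiable_comp (differentiable_q x) ds).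
Qed.

Lemma derive_enorm x v : x != 0 ->
  'D_v (@enorm R N) x = (\sum_i x 0 i * v 0 i) / enorm x.
Proof.
move=> x0; have qx := q_gt0 x0; have e0 : enorm x != 0 by rewrite enorm_eq0.
have [ds es] := is_derive1_sqrt qx.
rewrite (derive_comp1 v (differentiable_q x) ds) derive1E es derive_q.
by rewrite -/(enorm x); field.
Qed.

Lemma grad_enorm x : x != 0 -> grad (@enorm R N) x = (enorm x)^-1 *: x.
Proof.
move=> x0; apply/rowP => i; rewrite !mxE derive_enorm// mulrC; congr (_ * _).
rewrite (bigD1 i)//= big1 ?addr0.
  by rewrite mxE !eqxx mulr1.
by move=> j ji; rewrite mxE (negbTE ji) andbF mulr0.
Qed.

Lemma hess_enorm x i j : x != 0 ->
  hess (@enorm R N) x i j =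
  (enorm x)^-1 * ((i == j)%:R - x 0 i / enorm x * (x 0 j / enorm x)).
Proof.
move=> x0; rewrite mxE.
have e : {near x, (fun y => 'D_(delta_mx 0 j) (@enorm R N) y) =1
     (fun y => y 0 j * (enorm y)^-1)}.
  have : nbhs x [set y : 'rV[R]_N | y != 0].
    by apply: open_nbhs_nbhs; split => //; exact: open_ne0.
  apply: filterS => y y0; have := grad_enorm y0.
  by move=> /(congr1 (fun M : 'rV[R]_N => M 0 j)); rewrite !mxE mulrC.
rewrite (near_eq_derive _ e).
have e0 : enorm x != 0 by rewrite enorm_eq0.
have de : derivable (@enorm R N) x (delta_mx 0 i).
  exact: (diff_derivable (differentiable_enorm x0)).
have dc : derivable (fun y : 'rV[R]_N => y 0 j) x (delta_mx 0 i).
  by apply: diff_derivable; exact: differentiable_coord.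
rewrite (deriveM dc (derivableV e0 de)) derive_coord (deriveV e0 de).
have := grad_enorm x0; move=> /(congr1 (fun M : 'rV[R]_N => M 0 i)); rewrite !mxE => ->.
rewrite eqxx/= eq_sym /GRing.scale/=.
by field.
Qed.

End enorm.

Lemma sum_norm_le (R : numDomainType) (N : nat) (f : 'I_N -> R) (b : R) :
  (forall i, `|f i| <= b) -> `|\sum_i f i| <= N%:R * b.
Proof.
move=> fb; apply: (le_trans (ler_norm_sum _ _ _)).
by rewrite -[N in leRHS]card_ord mulr_natl -sumr_const ler_sum.
Qed.

Lemma ler_normM (R : numDomainType) (x y a b : R) :
  `|x| <= a -> `|y| <= b -> `|x * y| <= a * b.
Proof. by move=> xa yb; rewrite normrM ler_pM. Qed.

Lemma powR_lt_near0 (R : realType) (a e : R) : 0 < a -> 0 < e ->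
  exists2 rho, 0 < rho & forall s, 0 <= s < rho -> s `^ a < e.
Proof.
move=> a0 e0; exists (e `^ a^-1); first exact: powR_gt0.
move=> s /andP[s0 se].
rewrite (_ : e = (e `^ a^-1) `^ a); last first.
  by rewrite -powRrM mulVf ?gt_eqF// powRr1// ltW.
by rewrite gt0_ltr_powR// nnegrE ltW// powR_gt0.
Qed.

Lemma powR_enorm_near0 (R : realType) (N : nat) (a e : R) : 0 < a -> 0 < e ->
  \forall x \near (0 : 'rV[R]_N), enorm x `^ a < e.
Proof.
move=> a0 e0; have [rho rho0 rhoP] := powR_lt_near0 a0 e0.
apply: filterS (enorm_near0 N rho0) => x xrho.
by apply: rhoP; rewrite enorm_ge0.
Qed.

(* The last two bounds say that d grad d = grad (d^2/2) and its differential are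
   close to the position vector and to the identity. *)
Definition almost_radial (R : realType) (N : nat) (d : 'rV[R]_N -> R)
    (alpha K : R) (x : 'rV[R]_N) : Prop :=
  let e := enorm x `^ alpha in
  [/\ enorm x <= 2 * d x /\ d x <= 2 * enorm x,
      grad d x != 0,
      enorm (grad d x) ^+ 2 <= 1 + K * e,
      forall j, `|d x * grad d x 0 j - x 0 j| <= K * e * enorm x &
      forall i j, `|grad d x 0 i * grad d x 0 j + d x * hess d x i j
        - (i == j)%:R| <= K * e].

(** * Expansion of the distortion at the origin *)

Section distortion.
Variables (R : realType) (N : nat) (Gam : set 'rV[R]_N) (alpha : R).
Variable d : 'rV[R]_N -> R.
Hypothesis dist : distortion Gam alpha d.

Lemma distortion0 : d 0 = 0.
Proof.
have [/andP[a0 _] _ [/eqO_exP[k k0 kd] _ _] _] := dist.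
have := nbhs_singleton kd.
rewrite enorm0 subr0 powR0 ?normr0 ?mulr0 ?normr_le0; first by move/eqP.
by rewrite gt_eqF// addr_gt0.
Qed.

(** The error of d is divided by |x| and that of the Hessian multiplied by |x|. All three errors
    then have the common size |x|^alpha, and products of them can be estimated without tracking
    powers of |x|. *)
Lemma distortion_expansion : exists2 b : R, 0 < b &
  \forall x \near (0 : 'rV[R]_N), x != 0 ->
  [/\ exists2 f, `|f| <= b * enorm x `^ alpha & d x = enorm x * (1 + f),
      forall i, exists2 e, `|e| <= b * enorm x `^ alpha &
        grad d x 0 i = x 0 i / enorm x + e &
      forall i j, exists2 h, `|h| <= b * enorm x `^ alpha &
        hess d x i j = (enorm x)^-1 *
          ((i == j)%:R - x 0 i / enorm x * (x 0 j / enorm x) + h)].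
Proof.
have [/andP[a0 _] _ [/eqO_exP[k0 k00 dk] /eqO_exP[k1 k10 gk] /eqO_exP[k2 k20 hk]] _] := dist.
exists (k0 + k1 + k2); first by rewrite !addr_gt0.
have gk' : \forall x \near (0 : 'rV[R]_N), x != 0 ->
  `|grad d x - grad (@enorm R N) x| <= k1 * `|enorm x `^ alpha| by exact: gk.
have hk' : \forall x \near (0 : 'rV[R]_N), x != 0 ->
  `|hess d x - hess (@enorm R N) x| <= k2 * `|enorm x `^ (alpha - 1)| by exact: hk.
near=> x => x0.
have r0 : 0 < enorm x by rewrite enorm_gt0.
have rN : enorm x != 0 by rewrite gt_eqF.
have e0 : 0 <= enorm x `^ alpha by exact: powR_ge0.
have b0 : k0 <= k0 + k1 + k2 by rewrite -addrA lerDl addr_ge0// ltW.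
have b1 : k1 <= k0 + k1 + k2 by rewrite addrAC lerDr addr_ge0// ltW.
have b2 : k2 <= k0 + k1 + k2 by rewrite lerDr addr_ge0// ltW.
split.
- have xk : `|d x - enorm x| <= k0 * `|enorm x `^ (1 + alpha)| by near: x.
  exists ((d x - enorm x) / enorm x); last by field.
  rewrite normrM normfV (ger0_norm (ltW r0)) ler_pdivrMr// (le_trans xk)//.
  rewrite ger0_norm ?powR_ge0// powRD ?rN ?implybT// powRr1 ?(ltW r0)//.
  rewrite (_ : _ * _ = k0 * enorm x `^ alpha * enorm x); last by ring.
  by rewrite ler_wpM2r ?(ltW r0)// ler_wpM2r.
- move=> i; exists (grad d x 0 i - x 0 i / enorm x); last by rewrite addrC subrK.
  have xk : `|grad d x - grad (@enorm R N) x| <= k1 * `|enorm x `^ alpha|.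
    by move: x0; near: x.
  rewrite (_ : _ - _ = (grad d x - grad (@enorm R N) x) 0 i); last first.
    by rewrite [in RHS]mxE [X in _ = _ + X]mxE grad_enorm// [X in _ = _ - X]mxE mulrC.
  apply: (le_trans (mx_entry_norm_le _ _ _)); apply: (le_trans xk).
  by rewrite ger0_norm// ler_wpM2r.
- move=> i j.
  exists (enorm x * (hess d x i j - hess (@enorm R N) x i j)); last first.
    have aux (H H' A r : R) : r != 0 -> H' = r^-1 * A ->
        H = r^-1 * (A + r * (H - H')) by move=> ? ->; field.
    exact: aux rN (hess_enorm i j x0).
  have xk : `|hess d x - hess (@enorm R N) x| <= k2 * `|enorm x `^ (alpha - 1)|.
    by move: x0; near: x.
  rewrite (_ : _ - _ = (hess d x - hess (@enorm R N) x) i j); last first.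
    by rewrite [in RHS]mxE [X in _ = _ + X]mxE.
  rewrite normrM (ger0_norm (ltW r0)).
  apply: (@le_trans _ _ (enorm x * (k2 * `|enorm x `^ (alpha - 1)|))).
    rewrite ler_wpM2l ?(ltW r0)//.
    by apply: le_trans xk; exact: mx_entry_norm_le.
  rewrite ger0_norm ?powR_ge0// mulrCA mulr_powRB1 ?(ltW r0)//.
  by rewrite ler_wpM2r.
Unshelve. all: by end_near. Qed.

Lemma distortion_estimates : exists2 K : R, 0 < K &
  \forall x \near (0 : 'rV[R]_N), x != 0 -> almost_radial d alpha K x.
Proof.
have [/andP[a0 _] _ _ _] := dist.
have [b b0 db] := distortion_expansion.
have Nb : 0 <= N%:R * b by rewrite mulr_ge0// ltW.
(* With e = |x|^alpha, the part 5 b + 2 b^2 counts the error terms in the last bound of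
   [almost_radial], five of size b e and two of size (b e)^2 <= b^2 e. The part in parentheses
   bounds the excess of |grad d|^2 over 1, which consists of N cross terms and N squares. *)
exists (5 * b + 2 * b ^+ 2 + (2 * N%:R * b + N%:R * b ^+ 2)).
  by rewrite ltr_pwDl ?addr_gt0 ?addr_ge0 ?mulr_gt0 ?mulr_ge0 ?exprn_gt0 ?sqr_ge0 ?(ltW b0).
(* The threshold 1 / D on |x|^alpha makes both b |x|^alpha and N b |x|^alpha at most 1/2. The first
   gives the comparison of d with |x|, the second the nonvanishing of the gradient. *)
have [D D0 DN] : exists2 D, 0 < D & 2 * (b + N%:R * b) <= D.
  exists (2 * (b + N%:R * b)) => //; rewrite mulr_gt0// ltr_pwDl//.
have eD : \forall x \near (0 : 'rV[R]_N), enorm x `^ alpha < D^-1.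
  by apply: powR_enorm_near0; rewrite ?invr_gt0.
have e1 : \forall x \near (0 : 'rV[R]_N), enorm x `^ alpha < 1.
  exact: powR_enorm_near0.
near=> x => x0.
have eD' : enorm x `^ alpha < D^-1 by near: x.
have e1' : enorm x `^ alpha < 1 by near: x.
have [[f fb dE] gE hE] : [/\ exists2 f, `|f| <= b * enorm x `^ alpha & d x = enorm x * (1 + f),
      forall i, exists2 e, `|e| <= b * enorm x `^ alpha &
        grad d x 0 i = x 0 i / enorm x + e &
      forall i j, exists2 h, `|h| <= b * enorm x `^ alpha &
        hess d x i j = (enorm x)^-1 *
          ((i == j)%:R - x 0 i / enorm x * (x 0 j / enorm x) + h)].
  by move: x0; near: x.
have r0 : 0 < enorm x by rewrite enorm_gt0.
have u1 i : `|x 0 i / enorm x| <= 1.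
  rewrite normrM normfV (ger0_norm (ltW r0)) ler_pdivrMr// mul1r.
  exact: entry_le_enorm.
have su : \sum_i (x 0 i / enorm x) ^+ 2 = 1.
  under eq_bigr do rewrite exprMn.
  by rewrite -mulr_suml -enorm_sqr -exprMn mulfV ?expr1n// gt_eqF.
rewrite /almost_radial /=.
move: (enorm x) (enorm x `^ alpha) (powR_ge0 (enorm x) alpha) r0 u1 su eD' e1' dE gE hE fb.
move=> r e e0 r0 u1 su eD' e1' dE gE hE fb /=.
have be : b * e <= 2^-1 /\ N%:R * (b * e) <= 2^-1.
  have : 2 * (b * e + N%:R * (b * e)) <= 1.
    rewrite (_ : _ * _ = 2 * (b + N%:R * b) * e); last by ring.
    apply: (@le_trans _ _ (D * D^-1)); last by rewrite mulfV ?gt_eqF.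
    by rewrite ler_pM// ?(ltW eD')// mulr_ge0// addr_ge0// ltW.
  have : 0 <= b * e by rewrite mulr_ge0// ltW.
  have : 0 <= N%:R * (b * e) by rewrite mulr_ge0// mulr_ge0// ltW.
  by move=> h1 h2 h3; split; lra.
have [be1 Nbe1] := be.
have be0 : 0 <= b * e by rewrite mulr_ge0// ltW.
have b2e : (b * e) * (b * e) <= b ^+ 2 * e.
  rewrite (_ : _ * _ = b ^+ 2 * e * e); last by ring.
  by rewrite ler_piMr// ?(ltW e1')// mulr_ge0// sqr_ge0.
have N0 : 0 <= N%:R :> R by [].
have Nb2 : 0 <= N%:R * b ^+ 2 * e by rewrite !mulr_ge0// ltW.
have Nb1 : 0 <= N%:R * b * e by rewrite !mulr_ge0// ltW.
have b2 : 0 <= b ^+ 2 * e by rewrite !mulr_ge0// ltW.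
have [w wE] : exists w : 'I_N -> R, forall i,
    `|w i| <= b * e /\ grad d x 0 i = x 0 i / r + w i.
  exists (fun i => grad d x 0 i - x 0 i / r) => i; have [w wb ->] := gE i.
  by rewrite addrAC subrr add0r.
have suw : `|\sum_i (x 0 i / r) * w i| <= N%:R * (b * e).
  by apply: sum_norm_le => i; rewrite -[leRHS]mul1r; apply: ler_normM => //; exact: (wE i).1.
split.
- rewrite dE; move: fb; rewrite ler_norml => /andP[f1 f2].
  by split; nra.
(* A zero gradient would force w = - x / |x|, whose inner product with x / |x| is -1, whereas [suw]
   bounds that product by 1/2. *)
- apply/eqP => g0; have : \sum_i (x 0 i / r) * w i = -1.
    rewrite -su -sumrN; apply: eq_bigr => i _.
    have [_] := wE i; rewrite g0 mxE => /esym/eqP; rewrite addrC addr_eq0 => /eqP ->.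
    by rewrite mulrN expr2.
  by move=> h; move: suw; rewrite h normrN1; lra.
- rewrite enorm_sqr.
  have -> : \sum_i grad d x 0 i ^+ 2 =
      1 + 2 * (\sum_i (x 0 i / r) * w i) + \sum_i w i ^+ 2.
    rewrite -[X in _ = X + _ + _]su mulr_sumr -!big_split/=; apply: eq_bigr => i _.
    by have [_ ->] := wE i; ring.
  have sw : \sum_i w i ^+ 2 <= N%:R * ((b * e) * (b * e)).
    apply: (le_trans (ler_norm _)); apply: sum_norm_le => i.
    by rewrite expr2; apply: ler_normM; exact: (wE i).1.
  have sw' : N%:R * ((b * e) * (b * e)) <= N%:R * (b ^+ 2 * e) by rewrite ler_wpM2l.
  move: suw; rewrite ler_norml => /andP[_ suw].
  have : 0 <= 5 * b * e + 2 * b ^+ 2 * e by rewrite addr_ge0// !mulr_ge0// ltW.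
  by nra.
- move=> j; have [wb ->] := wE j.
  have -> : d x * (x 0 j / r + w j) - x 0 j = r * (w j + f * (x 0 j / r) + f * w j).
    by rewrite dE; field; rewrite gt_eqF.
  rewrite normrM (ger0_norm (ltW r0)) mulrC ler_wpM2r ?(ltW r0)//.
  have h1 : `|f * (x 0 j / r)| <= b * e * 1 by exact: ler_normM.
  have h2 : `|f * w j| <= b * e * (b * e) by exact: ler_normM.
  have := ler_normD (w j + f * (x 0 j / r)) (f * w j).
  have := ler_normD (w j) (f * (x 0 j / r)).
  by nra.
move=> i j; have [wi ->] := wE i; have [wj ->] := wE j; have [h hb ->] := hE i j.
move: (u1 i) (u1 j); set ui := x 0 i / r; set uj := x 0 j / r; set dl := (i == j)%:R => ui1 uj1.
have -> : (ui + w i) * (uj + w j) + d x * (r^-1 * (dl - ui * uj + h)) - dl =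
    ui * w j + w i * uj + w i * w j + h + f * h + f * (dl - ui * uj).
  by rewrite dE; field; rewrite gt_eqF.
have h1 : `|ui * w j| <= 1 * (b * e) by exact: ler_normM.
have h2 : `|w i * uj| <= b * e * 1 by exact: ler_normM.
have h3 : `|w i * w j| <= b * e * (b * e) by exact: ler_normM.
have h4 : `|f * h| <= b * e * (b * e) by exact: ler_normM.
have h5 : `|f * (dl - ui * uj)| <= b * e * 2.
  apply: ler_normM => //; apply: (le_trans (ler_normB _ _)).
  rewrite -[leRHS]/(1 + 1); apply: lerD.
    by rewrite /dl; case: (i == j); rewrite ?normr1 ?normr0.
  by rewrite -[leRHS]mulr1; exact: ler_normM.
have := ler_normD (ui * w j + w i * uj + w i * w j + h + f * h) (f * (dl - ui * uj)).
have := ler_normD (ui * w j + w i * uj + w i * w j + h) (f * h).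
have := ler_normD (ui * w j + w i * uj + w i * w j) h.
have := ler_normD (ui * w j + w i * uj) (w i * w j).
have := ler_normD (ui * w j) (w i * uj).
by nra.
Unshelve. all: by end_near. Qed.

End distortion.

(** * The cutoff and the test field *)

Lemma near_norm_lt (R : numFieldType) (V : normedModType R) (x : V) (e : R) :
  `|x| < e -> \forall y \near x, `|y| < e.
Proof. exact: (@cvgr_norm_lt _ _ _ (nbhs x) _ id x (@cvg_id _ _) e). Qed.

Lemma near_norm_gt (R : numFieldType) (V : normedModType R) (x : V) (e : R) :
  e < `|x| -> \forall y \near x, e < `|y|.
Proof. exact: (@cvgr_norm_gt _ _ _ (nbhs x) _ id x (@cvg_id _ _) e). Qed.

Lemma compact_norm_le (R : realType) (N : nat) (e : R) :
  compact [set x : 'rV[R]_N | `|x| <= e].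
Proof.
apply: bounded_closed_compact.
  exists e; split; first by rewrite num_real.
  by move=> t et x /= /le_trans; apply; exact: ltW.
rewrite (_ : [set _ | _] = ~` [set x | e < `|x|]); last first.
  by apply/seteqP; split => x /=; rewrite leNgt => /negP.
by apply: open_closedC; rewrite openE => x ex; exact: (@near_norm_gt R 'rV[R]_N x e ex).
Qed.

Lemma near_cst_derive1 (R : realType) (f : R -> R) (t k : R) :
  (\forall u \near t, f u = k) -> derivable f t 1 /\ derive1 f t = 0.
Proof.
move=> fk; have kf : {near t, cst k =1 f} by apply: filterS fk => u ->.
split; first exact: near_eq_derivable kf (derivable_cst _ _ _).
by rewrite derive1E -(near_eq_derive _ kf) derive_cst.
Qed.

Section cutoff.
Variables (R : realType) (phi : R -> R).
Hypothesis cphi : cutoff phi.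

Lemma cutoff_flat : exists2 delta, 0 < delta <= 1 &
  forall t, `|t| < delta -> phi t = phi 0 /\ derive1 phi t = 0.
Proof.
have [_ _ _ /nbhs_ballP[e /= e0 eP]] := cphi.
exists (Num.min e 1); first by rewrite lt_min e0 ltr01 ge_min lexx orbT.
move=> t; rewrite lt_min => /andP[te _].
have bt u : `|u| < e -> phi u = phi 0.
  by move=> ue; apply: eP; rewrite /ball/= sub0r normrN.
split; first exact: bt.
apply: (near_cst_derive1 (k := phi 0) _).2.
by apply: filterS (near_norm_lt te) => u; exact: bt.
Qed.

Lemma cutoff_ge1 t : 1 <= t -> phi t = 0 /\ derive1 phi t = 0.
Proof.
move=> t1; have [_ [c /andP[_ c1] pc] _ _] := cphi.
split; first by apply: pc; rewrite (le_trans (ltW c1)).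
apply: (near_cst_derive1 (k := 0) _).2.
have : \forall u \near t, c < u by apply: lt_nbhsr; exact: lt_le_trans t1.
by apply: filterS => u /ltW; exact: pc.
Qed.

(** [cutoff] grants regularity on (0, 1); since phi vanishes from some c < 1 on, it persists across
    1 and beyond. *)
Lemma cutoff_C1 t : 0 < t ->
  derivable phi t 1 /\ {for t, continuous (derive1 phi)}.
Proof.
move=> t0; have [dphi [c /andP[_ c1] pc] _ _] := cphi.
have [t1|t1] := ltP t 1; first by apply: dphi; rewrite t0.
have ct : \forall u \near t, c < u by apply: lt_nbhsr; exact: lt_le_trans t1.
have flat u : c < u -> derivable phi u 1 /\ derive1 phi u = 0.
  move=> cu; apply: (near_cst_derive1 (k := 0)).
  by apply: filterS (lt_nbhsr cu) => v /ltW; exact: pc.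
split; first by have [] := flat t (nbhs_singleton ct).
apply: (@near_eq_continuous _ _ (cst 0)); last exact: cst_continuous.
by apply: filterS ct => u /flat[_ ->].
Qed.

Lemma cutoff_ge0 t : 0 <= t -> 0 <= phi t.
Proof.
move=> t0; have [_ [c /andP[c0 c1] pc] dec _] := cphi.
have [ct|tc] := leP c t; first by rewrite pc.
by rewrite -(pc c (lexx _)); apply: dec => //; exact: ltW.
Qed.

Lemma cutoff_derive1_le0 t : 0 < t -> derive1 phi t <= 0.
Proof.
move=> t0; have [t1|t1] := leP 1 t; first by rewrite (cutoff_ge1 t1).2.
have [dphi _ dec _] := cphi.
have [dt _] := cutoff_C1 t0.
apply: limr_le.
  by move: dt; rewrite /derivable; under eq_fun do rewrite scaler1.
near=> h.
have h0 : h != 0 by near: h; exact: nbhs_dnbhs_neq.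
have ht : 0 < h + t.
  have : `|h| < t by near: h; exact: dnbhs0_lt.
  by rewrite ltr_norml => /andP[]; lra.
have ht1 : h + t < 1.
  have : `|h| < 1 - t by near: h; apply: dnbhs0_lt; rewrite subr_gt0.
  by rewrite ltr_norml => /andP[]; lra.
move: h0; rewrite neq_lt => /orP[h0|h0].
- rewrite nmulr_rle0 ?invr_lt0// subr_ge0; apply: dec => //; first exact: ltW.
  by rewrite gerDr ltW.
- rewrite pmulr_rle0 ?invr_gt0// subr_le0; apply: dec => //; first exact: ltW.
  by rewrite lerDr ltW.
Unshelve. all: by end_near. Qed.

(** The derivative is continuous on the compact interval [delta / 2, 1] and zero on the rest of the
    half-line. The bound feeds the dominating function in [derive_integral_cutoff]. *)
Lemma cutoff_derive1_bounded :
  exists2 M, 0 <= M & forall t, 0 <= t -> `|derive1 phi t| <= M.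
Proof.
have [delta /andP[d0 d1] flat] := cutoff_flat.
have d20 : 0 < delta / 2 by rewrite divr_gt0.
have : compact (derive1 phi @` `[delta / 2, 1]).
  apply: continuous_compact; last exact: segment_compact.
  apply: continuous_in_subspaceT => t /set_mem /=; rewrite in_itv/= => /andP[dt _].
  by apply: (cutoff_C1 _).2; exact: lt_le_trans dt.
move/compact_bounded => [M [Mr pM]].
exists (`|M| + 1); first by rewrite addr_ge0.
move=> t t0; have [t1|t1] := leP 1 t.
  by rewrite (cutoff_ge1 t1).2 normr0 addr_ge0.
have [dt|td] := leP (delta / 2) t.
  apply: (pM (`|M| + 1)); first by rewrite (le_lt_trans (ler_norm _))// ltrDl.
  by exists t => //=; rewrite in_itv/= dt ltW.
rewrite (flat t _).2 ?normr0 ?addr_ge0// ger0_norm// (lt_le_trans td)//.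
by rewrite ler_pdivrMr// mulr_natr mulr2n lerDl ltW.
Qed.

End cutoff.

(** * Directional derivatives, tangent vectors and the regularity of the test field *)

Lemma derive_partials (R : realType) (N : nat) (f : 'rV[R]_N -> R)
    (x v : 'rV[R]_N) :
  differentiable f x -> 'D_v f x = \sum_i v 0 i * 'D_(delta_mx 0 i) f x.
Proof.
move=> df; rewrite deriveE// [in LHS](row_sum_delta v) linear_sum.
by apply: eq_bigr => i _; rewrite linearZ/= -deriveE.
Qed.

Lemma derive1_scale_arg (R : realType) (f : R -> R) (s t : R) :
  derivable f (t / s) 1 ->
  derivable (fun u : R => f (u / s)) t 1 /\
  derive1 (fun u : R => f (u / s)) t = derive1 f (t / s) / s.
Proof.
move=> df.
have did : derivable (id : R -> R) t 1 by exact: derivable_id.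
have dic : derivable (cst s^-1 : R -> R) t 1 by exact: derivable_cst.
have di : derivable (fun u : R => u / s) t 1 by exact: (derivableM did dic).
have Di : derive1 (fun u : R => u / s) t = s^-1.
  by rewrite (derive1Mr _ did) derive1_id mul1r.
split; last by have := derive1_comp di df; rewrite Di.
move/derivable1_diffP : di => di; move/derivable1_diffP : df => df.
by apply/derivable1_diffP; exact: (differentiable_comp di df).
Qed.

Lemma C1_on_cst (R : realType) (E F : normedModType R) (A : set E) (k : F) :
  C1_on A (cst k).
Proof.
move=> x _; split; first exact: differentiable_cst.
move=> v; rewrite (_ : 'D_v _ = cst 0); first exact: cst_continuous.
by apply/funext => y; rewrite derive_cst.
Qed.

Lemma tangent_space0 (R : realType) (N : nat) (Gam : set 'rV[R]_N)
    (p : 'rV[R]_N) : Gam p -> tangent_space Gam p 0.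
Proof.
move=> Gp; exists 1, (cst p); split => //; first exact: C1_on_cst.
exact: derive_cst.
Qed.

(** Tangent vectors are velocities of curves, so closure under scaling is a reparametrization t ->
    gam (a t), defined for |t| < e / |a|. The case a = 0 takes the constant curve instead. *)
Lemma tangent_spaceZ (R : realType) (N : nat) (Gam : set 'rV[R]_N)
    (p v : 'rV[R]_N) (a : R) :
  Gam p -> tangent_space Gam p v -> tangent_space Gam p (a *: v).
Proof.
move=> Gp [e [gam [e0 gC gG g0 gv]]].
have [->|a0] := eqVneq a 0; first by rewrite scale0r; exact: tangent_space0.
have ab t : ball (0 : R) (e / `|a|) t -> ball (0 : R) e (a * t).
  rewrite /ball/= !sub0r !normrN normrM ltr_pdivlMr ?normr_gt0//.
  by rewrite mulrC.
have dL (t : R) : differentiable ( *:%R a : R -> R) t.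
  by have [] := is_diff_scaler a t.
have LE (t : R) : 'd ( *:%R a : R -> R) t = *:%R a :> (R -> R).
  by have [] := is_diff_scaler a t.
pose g : R -> 'rV[R]_N := gam \o ( *:%R a : R -> R).
have dg t : ball (0 : R) (e / `|a|) t ->
    differentiable g t /\ forall w, 'D_w g t = 'D_(a * w) gam (a * t).
  move=> /ab /gC [dgam _].
  have dc : differentiable g t by exact: (differentiable_comp (dL t) dgam).
  split; first exact: dc.
  move=> w; rewrite (deriveE w dc) (deriveE (a * w) dgam).
  transitivity ('d gam (a * t) ('d ( *:%R a : R -> R) t w)).
    exact: (congr1 (fun h : R -> 'rV[R]_N => h w) (diff_comp (dL t) dgam)).
  by congr ('d gam _ _); rewrite LE.
exists (e / `|a|), g; split.
- by rewrite divr_gt0// normr_gt0.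
- move=> t tb; split; first by have [] := dg t tb.
  move=> w.
  apply: (@near_eq_continuous _ _ (fun u : R => 'D_(a * w) gam (a * u))).
    have : nbhs t (ball (0 : R) (e / `|a|)).
      by apply: open_nbhs_nbhs; split => //; apply: ball_open; rewrite divr_gt0 ?normr_gt0.
    by apply: filterS => u /dg[_ ->].
  have [_ /(_ (a * w)) cg] := gC _ (ab t tb).
  have cL : {for t, continuous ( *:%R a : R -> R)}.
    exact: (differentiable_continuous (dL t)).
  exact: (continuous_comp cL cg).
- by move=> t /ab; exact: gG.
- by rewrite /g/= [_ *: _]mulr0.
have b0 : ball (0 : R) (e / `|a|) 0.
  by apply: ballxx; rewrite divr_gt0// normr_gt0.
have [_ ->] := dg 0 b0; have [dgam _] := gC _ (ab 0 b0).
rewrite mulr1 mulr0 in dgam *.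
rewrite deriveE// -[X in 'd gam _ X]mulr1 linearZ/= -deriveE//.
by rewrite gv.
Qed.

(* The cut at `|x| < r only matters outside U, where nothing is known about d:
   on U the factor phi (d x / s) already vanishes for r / 2 < `|x|. *)
Definition test_field (R : realType) (N : nat) (phi : R -> R)
    (d : 'rV[R]_N -> R) (r s : R) (x : 'rV[R]_N) : 'rV[R]_N :=
  if `|x| < r then (phi (d x / s) * d x) *: grad d x else 0.

(** Collects what is known about d at a fixed scale. The factor 1/2 in the sublevel condition leaves
    the collar r / 2 < |x| < r, in which the test field is already zero. *)
Definition adapted_radius (R : realType) (N : nat) (U : set 'rV[R]_N)
    (d : 'rV[R]_N -> R) (alpha K r c : R) : Prop :=
  [/\ 0 < K, 0 < r,
      forall x, `|x| < r -> U x /\ (x != 0 -> almost_radial d alpha K x),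
      forall x, U x -> d x < c -> enorm x < r / 2 &
      forall x, U x -> x != 0 -> 0 < d x].

Section test_field.
Variables (R : realType) (N : nat) (U Gam : set 'rV[R]_N) (alpha : R).
Variables (d : 'rV[R]_N -> R) (phi : R -> R) (K r c s : R).
Hypotheses (dist : distortion Gam alpha d) (cphi : cutoff phi).
Hypothesis rad : adapted_radius U d alpha K r c.
Hypotheses (s0 : 0 < s) (sc : s <= c).

Let K0 : 0 < K. Proof. by case: rad. Qed.
Let r0 : 0 < r. Proof. by case: rad. Qed.
Let ballU x : `|x| < r -> U x. Proof. by case: rad => _ _ H _ _ /H[]. Qed.
Let est x : `|x| < r -> x != 0 -> almost_radial d alpha K x.
Proof. by case: rad => _ _ H _ _ /H[]. Qed.
Let sublevel x : U x -> d x < c -> enorm x < r / 2.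
Proof. by case: rad => _ _ _ + _; apply. Qed.
Let d_gt0 x : U x -> x != 0 -> 0 < d x.
Proof. by case: rad => _ _ _ _; apply. Qed.

Local Notation chi := (test_field phi d r s).

Lemma sublevel_le x : U x -> r / 2 < `|x| -> s <= d x.
Proof.
move=> Ux rx; rewrite leNgt; apply/negP => dxs.
have := sublevel Ux (lt_le_trans dxs sc).
by move/(le_lt_trans (norm_le_enorm x))/(lt_trans rx); rewrite ltxx.
Qed.

(** Outside the half ball d x >= c >= s, so the argument of phi is at least 1. *)
Lemma cutoff_far x : U x -> r / 2 < `|x| ->
  phi (d x / s) = 0 /\ derive1 phi (d x / s) = 0.
Proof.
by move=> Ux rx; apply: (cutoff_ge1 cphi); rewrite ler_pdivlMr// mul1r sublevel_le.
Qed.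

Lemma distortion_ratio_near0 (e : R) : 0 < e ->
  \forall x \near (0 : 'rV[R]_N), `|d x / s| < e.
Proof.
move=> e0; near=> x.
have [->|x0] := eqVneq x 0; first by rewrite (distortion0 dist) mul0r normr0.
have xr : `|x| < r by near: x; exact: (@nbhs0_lt R 'rV[R]_N).
have [[_ dx] _ _ _ _] := est xr x0.
rewrite ger0_norm ?divr_ge0 ?(ltW s0) ?(ltW (d_gt0 (ballU xr) x0))//.
rewrite ltr_pdivrMr// (le_lt_trans dx)// -ltr_pdivlMl//.
near: x; apply: enorm_near0.
by rewrite !mulr_gt0.
Unshelve. all: by end_near. Qed.

Lemma test_field_far x : r / 2 < `|x| -> chi x = 0.
Proof.
move=> rx; rewrite /test_field; case: ifPn => // xr.
by rewrite (cutoff_far (ballU xr) rx).1 mul0r scale0r.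
Qed.

(** The scalar factor of the test field as a function of t = d x alone: away from 0 the field is
    [psi (d x) *: grad d x], and its regularity reduces to that of [psi] on t > 0. *)
Let psi (t : R) := phi (t / s) * t.

Let derive1_psi t : 0 < t -> derivable psi t 1 /\
  derive1 psi t = derive1 phi (t / s) * (t / s) + phi (t / s).
Proof.
move=> t0; have [df cf] := cutoff_C1 cphi (divr_gt0 t0 s0).
have [dg gE] := derive1_scale_arg df.
have di : derivable (id : R -> R) t 1 by exact: derivable_id.
split; first exact: (derivableM dg di).
rewrite derive1E (deriveM dg di) derive_id -derive1E gE /GRing.scale/=.
by field; rewrite gt_eqF.
Qed.

Let psi_C1 t : 0 < t ->
  derivable psi t 1 /\ {for t, continuous (derive1 psi)}.
Proof.
move=> t0; split; first exact: (derive1_psi t0).1.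
have e : {near t, (fun t => derive1 phi (t / s) * (t / s) + phi (t / s))
    =1 derive1 psi}.
  by apply: filterS (lt_nbhsr t0) => u u0; rewrite (derive1_psi u0).2.
apply: (near_eq_continuous e).
have [df cf] := cutoff_C1 cphi (divr_gt0 t0 s0).
have cs : {for t, continuous (fun t : R => t / s)}.
  by apply: cvgMr_tmp; exact: cvg_id.
have c1 : {for t, continuous (fun t : R => derive1 phi (t / s))}.
  exact: (continuous_comp cs cf).
have c2 : {for t, continuous (fun t : R => phi (t / s))}.
  apply: (continuous_comp cs); apply: differentiable_continuous.
  by move/derivable1_diffP : df.
exact: (continuousD (continuousM c1 cs) c2).
Qed.

Let A : set 'rV[R]_N := [set x | x != 0] `&` [set x | `|x| < r].

Let oA : open A.
Proof.
apply: openI; first exact: open_ne0.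
by rewrite openE => x xr; exact: (@near_norm_lt R 'rV[R]_N x r xr).
Qed.

Let d_C1 : C1_on A d.
Proof. by have [_ [dC _] _ _] := dist; move=> x [x0 _]; exact: dC. Qed.

Let grad_C1 j : C1_on A (fun x => grad d x 0 j).
Proof.
have [_ [_ gC] _ _] := dist.
by move=> x [x0 _]; exact: ((C1_on_row _ (@open_ne0 R 'rV[R]_N)).1 gC j x x0).
Qed.

Let chi_entry x j : A x -> {near x, (fun y => psi (d y) * grad d y 0 j) =1
  (fun y => chi y 0 j)}.
Proof.
move=> [_ xr]; apply: filterS (near_norm_lt xr) => y yr.
by rewrite /test_field yr [RHS]mxE.
Qed.

Let chi_C1_A j : C1_on A (fun x => chi x 0 j).
Proof.
move=> x Ax.
have pC : C1_on A (psi \o d).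
  by apply: C1_on_comp => // y [y0 yr]; apply: psi_C1; apply: d_gt0 => //; exact: ballU.
apply: (near_eq_C1 (chi_entry j Ax)) => // _ ->.
exact: (C1_onM oA pC (grad_C1 j)).
Qed.

Let derive_chi x i j : A x -> 'D_(delta_mx 0 i) (fun y => chi y 0 j) x =
  derive1 phi (d x / s) * (d x / s) * (grad d x 0 i * grad d x 0 j) +
  phi (d x / s) * (grad d x 0 i * grad d x 0 j + d x * hess d x i j).
Proof.
move=> Ax; rewrite -(near_eq_derive _ (chi_entry j Ax)).
have dx0 : 0 < d x by have [x0 xr] := Ax; apply: d_gt0 => //; exact: ballU.
have [dd _] := d_C1 Ax; have [dg _] := grad_C1 j Ax.
have [dp pE] := derive1_psi dx0.
have dpd : derivable (psi \o d) x (delta_mx 0 i).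
  apply: diff_derivable; move/derivable1_diffP : dp => dp.
  exact: (differentiable_comp dd dp).
rewrite (deriveM dpd (diff_derivable dg)) (derive_comp1 _ dd dp) pE.
rewrite (_ : 'D_(delta_mx 0 i) d x = grad d x 0 i); last by rewrite mxE.
rewrite (_ : 'D_(delta_mx 0 i) (fun z => grad d z 0 j) x = hess d x i j); last first.
  by rewrite [RHS]mxE; congr ('D_(_) _ x); apply/funext => y; rewrite mxE.
by rewrite /GRing.scale/= /psi; ring.
Qed.

Let near0_flat : \forall x \near (0 : 'rV[R]_N),
  `|x| < r /\ phi (d x / s) = phi 0 /\ derive1 phi (d x / s) = 0.
Proof.
have [delta /andP[dl0 _] flat] := cutoff_flat cphi.
have xr : \forall x \near (0 : 'rV[R]_N), `|x| < r by exact: (@nbhs0_lt R 'rV[R]_N).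
have dd := distortion_ratio_near0 dl0.
by apply: filterS2 xr dd => x xr /flat.
Qed.

Let a0 : 0 < alpha. Proof. by have [/andP[]] := dist. Qed.

(** Near 0 the cutoff is frozen at [phi 0], so chi is phi(0) d grad d. This differs from phi(0) x by
    O(|x|^(1 + alpha)), which is o(|x|); [g] is the difference. *)
Let chi_diff0 j : differentiable (fun y => chi y 0 j) 0 /\
  forall v, 'D_v (fun y => chi y 0 j) (0 : 'rV[R]_N) = phi 0 * v 0 j.
Proof.
pose g (y : 'rV[R]_N) := chi y 0 j - phi 0 * y 0 j.
have [dg gE] : is_diff (0 : 'rV[R]_N) g 0.
  apply: littleo_is_diff0.
    rewrite /g /test_field normr0 r0 (distortion0 dist) mulr0 scale0r.
    by rewrite !mxE mulr0 subrr.
  move=> e e0.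
  (* Bound on |x|^alpha that makes the final product of constants equal to e; [|phi 0| + 1] and
     [N.+1] prevent a division by zero. *)
  have k0 : 0 < e / (K * (`|phi 0| + 1) * N.+1%:R).
    by rewrite divr_gt0// !mulr_gt0// ltr_wpDl.
  have := powR_enorm_near0 N a0 k0.
  apply: filterS2 near0_flat => x [xr [phix _]] xe.
  rewrite /g /test_field xr phix subr0.
  have [->|x0] := eqVneq x 0.
    by rewrite (distortion0 dist) mulr0 scale0r !mxE mulr0 subrr !normr0 mulr0.
  have [_ _ _ /(_ j) dj _] := est xr x0.
  rewrite !mxE -mulrA -mulrBr normrM.
  have h1 : `|d x * grad d x 0 j - x 0 j| <=
      K * (e / (K * (`|phi 0| + 1) * N.+1%:R)) * (N.+1%:R * `|x|).
    move: dj; rewrite mxE => /le_trans; apply; apply: ler_pM.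
    - by rewrite mulr_ge0 ?(ltW K0)// powR_ge0.
    - exact: enorm_ge0.
    - by rewrite ler_wpM2l ?(ltW K0)// ltW.
    - by rewrite (le_trans (enorm_le_norm x))// ler_wpM2r// ler_nat.
  move: h1; rewrite mxE => h1.
  apply: (@le_trans _ _ ((`|phi 0| + 1) *
      (K * (e / (K * (`|phi 0| + 1) * N.+1%:R)) * (N.+1%:R * `|x|)))).
    by apply: ler_pM => //; rewrite lerDl.
  have P0 : `|phi 0| + 1 != 0 by rewrite gt_eqF// ltr_wpDl.
  have K00 : K != 0 by rewrite gt_eqF.
  have N00 : N.+1%:R != 0 :> R by rewrite pnatr_eq0.
  rewrite le_eqVlt; apply/orP; left; apply/eqP.
  move: P0 K00 N00; move: (N.+1%:R : R) => n P0 K00 N00.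
  by field; rewrite P0 K00 N00.
have chiE : (fun y => chi y 0 j) = (fun y => g y + phi 0 * y 0 j).
  by apply/funext => y; rewrite /g subrK.
have dl : differentiable (fun y : 'rV[R]_N => phi 0 * y 0 j) (0 : 'rV[R]_N).
  exact: (differentiableZ (phi 0) (differentiable_coord _ 0 j)).
split; first by rewrite chiE; exact: (differentiableD dg dl).
move=> v; rewrite chiE (deriveD (diff_derivable dg) (diff_derivable dl)).
rewrite deriveE// gE add0r.
have dc : derivable (fun y : 'rV[R]_N => y 0 j) 0 v.
  by apply: diff_derivable; exact: differentiable_coord.
by rewrite (deriveZ (phi 0) dc) derive_coord.
Qed.

(** For x near 0 and different from 0, the phi' term of the derivative vanishes. What remains is
    phi(0) times a matrix within K |x|^alpha of the identity, hence it tends to the derivative found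
    at 0. *)
Let chi_C1_0 j : C1_on [set 0] (fun x => chi x 0 j).
Proof.
move=> _ ->; have [d0 D0] := chi_diff0 j; split => // v.
rewrite /prop_for /continuous_at D0.
apply/(@cvgrPdist_le _ _ _ (nbhs (0 : 'rV[R]_N))) => /= e e0.
have k0 : 0 < e / (K * (`|phi 0| + 1) * (N.+1%:R * (`|v| + 1))).
  by rewrite divr_gt0// !mulr_gt0// ltr_wpDl.
have := powR_enorm_near0 N a0 k0.
apply: filterS2 near0_flat => x [xr [phix dphix]] xe.
have [->|x0] := eqVneq x 0; first by rewrite D0 subrr normr0 ltW.
have Ax : A x by [].
have [dx _] := chi_C1_A j Ax.
rewrite (derive_partials _ dx).
under eq_bigr do rewrite derive_chi// dphix phix !mul0r add0r.
have -> : phi 0 * v 0 j = \sum_i v 0 i * (phi 0 * (i == j)%:R).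
  rewrite (bigD1 j)//= big1 ?addr0 ?eqxx ?mulr1 1?mulrC// => i ij.
  by rewrite (negbTE ij) !mulr0.
rewrite -sumrB.
have [_ _ _ _ dij] := est xr x0.
have h i : `|v 0 i * (phi 0 * (i == j)%:R) - v 0 i * (phi 0 *
    (grad d x 0 i * grad d x 0 j + d x * hess d x i j))| <=
    (`|v| + 1) * ((`|phi 0| + 1) * (K * (e / (K * (`|phi 0| + 1) * (N.+1%:R * (`|v| + 1)))))).
  rewrite -mulrBr -mulrBr; apply: ler_normM.
    by rewrite (le_trans (mx_entry_norm_le _ _ _))// lerDl.
  apply: ler_normM; first by rewrite lerDl.
  rewrite distrC (le_trans (dij i j))// ler_wpM2l ?(ltW K0)//.
  exact: ltW.
apply: (le_trans (sum_norm_le h)).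
have P0 : `|phi 0| + 1 != 0 by rewrite gt_eqF// ltr_wpDl.
have V0 : `|v| + 1 != 0 by rewrite gt_eqF// ltr_wpDl.
have K00 : K != 0 by rewrite gt_eqF.
have N00 : N.+1%:R != 0 :> R by rewrite pnatr_eq0.
apply: (@le_trans _ _ (N.+1%:R * ((`|v| + 1) * ((`|phi 0| + 1) *
    (K * (e / (K * (`|phi 0| + 1) * (N.+1%:R * (`|v| + 1))))))))).
  rewrite ler_wpM2r ?ler_nat//.
  rewrite mulr_ge0 ?addr_ge0// mulr_ge0 ?addr_ge0// mulr_ge0 ?(ltW K0)//.
  exact: ltW.
rewrite le_eqVlt; apply/orP; left; apply/eqP.
move: P0 V0 K00 N00; move: (N.+1%:R : R) (`|v| + 1) => n w P0 V0 K00 N00.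
by field; rewrite P0 K00 N00 V0.
Qed.

(** Three zones: the origin, the punctured ball of radius r, and its exterior, near each point of
    which chi is zero because of the collar. *)
Lemma test_field_C1 : C1_on setT chi.
Proof.
apply/(C1_on_row _ openT) => j x _.
have [->|x0] := eqVneq x 0; first exact: (chi_C1_0 j).
have [xr|rx] := ltP `|x| r.
  by apply: (chi_C1_A j).
have rx2 : r / 2 < `|x|.
  by rewrite (lt_le_trans _ rx)// ltr_pdivrMr// mulr_natr mulr2n ltrDl.
apply: (@near_eq_C1 _ _ _ (cst 0) _ x) => //.
  by apply: filterS (near_norm_gt rx2) => y /test_field_far ->; rewrite mxE.
exact: C1_on_cst.
Qed.

Lemma test_field_C1c : C1c U chi.
Proof.
have supp : closure [set x | chi x != 0] `<=` [set x | `|x| <= r / 2].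
  have : closed [set x : 'rV[R]_N | `|x| <= r / 2].
    by apply: compact_closed; [exact: norm_hausdorff|exact: compact_norm_le].
  rewrite closure_id => ->; apply: closure_subset => x /= /eqP chi0.
  by rewrite leNgt; apply/negP => rx; apply: chi0; exact: test_field_far.
split; first exact: test_field_C1.
- exact: subclosed_compact (@closed_closure _ _) (compact_norm_le (e := r / 2)) supp.
- move=> x /supp /= xr; apply: ballU; rewrite (le_lt_trans xr)//.
  by rewrite ltr_pdivrMr// mulr_natr mulr2n ltrDl.
Qed.

Lemma test_field_tangent : tangent_to Gam chi.
Proof.
have [_ _ _ tan] := dist.
move=> x Gx; rewrite /test_field; case: ifPn => xr; last exact: tangent_space0.
have [x0|x0] := eqVneq x 0.
  have -> : d x = 0 by rewrite x0 (distortion0 dist).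
  by rewrite mulr0 scale0r; exact: tangent_space0.
by apply: tangent_spaceZ => //; exact: tan.
Qed.

(** The origin is a separate case because [grad d] and [hess d] carry no information there. For |x|
    >= r the general formula still holds, both sides being zero. *)
Lemma jacobian_test_field x i j : U x -> 'J chi x i j =
  if x == 0 then phi 0 * (i == j)%:R else
  derive1 phi (d x / s) * (d x / s) * (grad d x 0 i * grad d x 0 j) +
  phi (d x / s) * (grad d x 0 i * grad d x 0 j + d x * hess d x i j).
Proof.
move=> Ux; have [dx _] := test_field_C1 (I : setT x).
have -> : 'J chi x i j = 'D_(delta_mx 0 i) (fun y => chi y 0 j) x.
  have := deriveEjacobian (delta_mx 0 i) dx.
  rewrite -rowE (derive_mx (diff_derivable dx)).
  by move=> /(congr1 (fun M : 'rV[R]_N => M 0 j)); rewrite !mxE => ->.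
case: eqVneq => [->|x0]; first by rewrite (chi_diff0 j).2 mxE eqxx eq_sym.
have [xr|rx] := ltP `|x| r; first exact: derive_chi.
have rx2 : r / 2 < `|x|.
  by rewrite (lt_le_trans _ rx)// ltr_pdivrMr// mulr_natr mulr2n ltrDl.
have [-> ->] := cutoff_far Ux rx2; rewrite !mul0r addr0.
rewrite -(derive_cst (0 : R) (delta_mx 0 i) x).
apply: near_eq_derive.
by apply: filterS (near_norm_gt rx2) => y /test_field_far ->; rewrite mxE.
Qed.

End test_field.

(** * The pointwise inequality *)

Section orthoproj.
Variables (R : realType) (N : nat) (P : 'M[R]_N).
Hypotheses (PT : P^T = P) (PP : P *m P = P).
Implicit Types v : 'rV[R]_N.

Lemma enorm_sqr_mul v : enorm v ^+ 2 = (v *m v^T) 0 0.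
Proof. by rewrite enorm_sqr mxE; apply: eq_bigr => i _; rewrite mxE expr2. Qed.

Lemma enorm_orthoproj v : enorm (v *m P) ^+ 2 = (v *m P *m v^T) 0 0.
Proof. by rewrite enorm_sqr_mul trmx_mul PT mulmxA -(mulmxA v) PP. Qed.

Lemma enorm_orthoproj_sum v :
  enorm (v *m P) ^+ 2 = \sum_i \sum_j P i j * (v 0 j * v 0 i).
Proof.
rewrite enorm_orthoproj mxE [RHS]exchange_big/=; apply: eq_bigr => j _.
by rewrite !mxE mulr_suml; apply: eq_bigr => i _; ring.
Qed.

End orthoproj.

Lemma enorm_pythagoras (R : realType) (N : nat) (P : 'M[R]_N) (v : 'rV[R]_N) :
  P^T = P -> P *m P = P ->
  enorm v ^+ 2 = enorm (v *m P) ^+ 2 + enorm (v *m (1%:M - P)) ^+ 2.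
Proof.
move=> PT PP; have QT : (1%:M - P)^T = 1%:M - P by rewrite raddfB/= trmx1 PT.
have QQ : (1%:M - P) *m (1%:M - P) = 1%:M - P.
  by rewrite mulmxBl mul1mx mulmxBr mulmx1 PP subrr subr0.
rewrite (enorm_orthoproj PT PP) (enorm_orthoproj QT QQ) enorm_sqr_mul.
rewrite mulmxBr mulmx1 mulmxBl [X in _ = _ + X]mxE [X in _ = _ + (_ + X)]mxE.
by rewrite addrC subrK.
Qed.

Lemma enormZ (R : realType) (N : nat) (a : R) (v : 'rV[R]_N) :
  enorm (a *: v) ^+ 2 = a ^+ 2 * enorm v ^+ 2.
Proof.
by rewrite !enorm_sqr mulr_sumr; apply: eq_bigr => i _; rewrite mxE exprMn.
Qed.

(** Converts the tangential quantity |P grad d|^2, which the divergence produces, into the normal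
    quantity p of the conclusion. *)
Lemma enorm_normalize_perp (R : realType) (N : nat) (P : 'M[R]_N) (v : 'rV[R]_N) :
  P^T = P -> P *m P = P -> v != 0 ->
  let p := enorm (((enorm v)^-1 *: v) *m (1%:M - P)) ^+ 2 in
  0 <= p <= 1 /\ enorm (v *m P) ^+ 2 = enorm v ^+ 2 * (1 - p).
Proof.
move=> PT PP v0 p.
have ev : 0 < enorm v ^+ 2 by rewrite exprn_gt0// enorm_gt0.
have pE : enorm v ^+ 2 * p = enorm (v *m (1%:M - P)) ^+ 2.
  by rewrite /p -scalemxAl enormZ exprVn mulrA mulfV ?mul1r// gt_eqF.
have vE := enorm_pythagoras v PT PP.
have p0 : 0 <= p by exact: sqr_ge0.
have vP : enorm (v *m P) ^+ 2 = enorm v ^+ 2 * (1 - p).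
  by rewrite mulrBr mulr1 pE vE addrK.
split => //; rewrite p0/= -subr_ge0 -(pmulr_rge0 _ ev) -vP.
exact: sqr_ge0.
Qed.

Section monotonicity_integrand.
Variables (R : realType) (N m : nat) (U Gam : set 'rV[R]_N) (alpha : R).
Variables (d : 'rV[R]_N -> R) (phi : R -> R) (K r c s : R).
Hypotheses (dist : distortion Gam alpha d) (cphi : cutoff phi).
Hypothesis rad : adapted_radius U d alpha K r c.
Hypotheses (s0 : 0 < s) (sc : s <= c).

Let K0 : 0 < K. Proof. by case: rad. Qed.
Let r0 : 0 < r. Proof. by case: rad. Qed.
Let ballU x : `|x| < r -> U x. Proof. by case: rad => _ _ H _ _ /H[]. Qed.
Let est x : `|x| < r -> x != 0 -> almost_radial d alpha K x.
Proof. by case: rad => _ _ H _ _ /H[]. Qed.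
Let sublevel x : U x -> d x < c -> enorm x < r / 2.
Proof. by case: rad => _ _ _ + _; apply. Qed.
Let d_gt0 x : U x -> x != 0 -> 0 < d x.
Proof. by case: rad => _ _ _ _; apply. Qed.

Local Notation chi := (test_field phi d r s).

(** [eps] is tr (P B), where B is the deviation of the differential of d grad d from the identity;
    the identity itself contributes tr P = m. The entries of P are at most 1, so the crude count of
    N^2 terms suffices. *)
Lemma trace_test_field x (P : 'M[R]_N) : U x -> Grass m P -> x != 0 ->
  `|x| < r -> exists2 eps, `|eps| <= N%:R * (N%:R * (K * enorm x `^ alpha)) &
  \tr (P *m 'J chi x) =
    derive1 phi (d x / s) * (d x / s) * enorm (grad d x *m P) ^+ 2 +
    phi (d x / s) * (m%:R + eps).
Proof.
move=> Ux [PT PP rP] x0 xr.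
have [_ _ _ _ dij] := est xr x0.
pose B i j := grad d x 0 i * grad d x 0 j + d x * hess d x i j - (i == j)%:R.
exists (\sum_i \sum_j P i j * B j i).
  apply: sum_norm_le => i; apply: sum_norm_le => j.
  rewrite -[leRHS]mul1r; apply: ler_normM; last exact: dij.
  exact: orthoproj_entry_le1.
rewrite -rP -(mxtrace_idempotent PP) (enorm_orthoproj_sum PT PP) /mxtrace.
rewrite -big_split/= !mulr_sumr -big_split/=; apply: eq_bigr => i _.
rewrite mxE [P i i](_ : _ = \sum_j P i j * (j == i)%:R); last first.
  rewrite (bigD1 i)//= eqxx mulr1 big1 ?addr0// => j ji.
  by rewrite (negbTE ji) mulr0.
rewrite -big_split/= !mulr_sumr -big_split/=; apply: eq_bigr => j _.
have -> := jacobian_test_field dist cphi rad s0 sc j i Ux.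
rewrite (negbTE x0) /B.
ring.
Qed.

(* w is s^(alpha - 1). The multiplier (1 - 2 K S) / s of the divergence is chosen
   so that (1 - 2 K S) * |grad d|^2 <= 1; s <= delta gives s <= d x / s wherever
   phi' (d x / s) != 0. *)
Lemma integrand_ge0 (delta C S w : R) x (P : 'M[R]_N) :
  (forall t, `|t| < delta -> phi t = phi 0 /\ derive1 phi t = 0) ->
  0 < delta -> s <= delta -> S = s `^ alpha -> s * w = S -> K * (2 * S) <= 1 ->
  2 * K * (m%:R + N%:R * N%:R) <= C ->
  U x -> Grass m P ->
  0 <= - derive1 phi (d x / s) * (d x / s ^+ 2) +
    derive1 phi (d x / s) *
      enorm (((enorm (grad d x))^-1 *: grad d x) *m (1%:M - P)) ^+ 2 -
    (m%:R / s - C * w) * phi (d x / s) +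
    (1 - K * (2 * S)) / s * \tr (P *m 'J chi x).
Proof.
move=> flat dl0 sdl SE sw KS CK Ux GP.
have [PT PP rP] := GP.
have S0 : 0 <= S by rewrite SE powR_ge0.
have sN : s != 0 by rewrite gt_eqF.
have mN : 0 <= m%:R :> R by [].
have NN : 0 <= N%:R * N%:R :> R by rewrite mulr_ge0.
have wE : w = S / s by rewrite -sw mulrC mulKf.
have CS : 0 <= C * S - 2 * K * (m%:R + N%:R * N%:R) * S.
  by rewrite -mulrBl mulr_ge0// subr_ge0.
have KS0 : 0 <= K * S by rewrite mulr_ge0 ?(ltW K0).
have [x0|x0] := eqVneq x 0.
  have q0 : d x / s = 0 by rewrite x0 (distortion0 dist) mul0r.
  have [_ dq] : phi 0 = phi 0 /\ derive1 phi 0 = 0 by apply: flat; rewrite normr0.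
  have b0 : 0 <= phi 0 by exact: (cutoff_ge0 cphi).
  have -> : \tr (P *m 'J chi x) = phi 0 * m%:R.
    rewrite -rP -(mxtrace_idempotent PP) /mxtrace mulr_sumr; apply: eq_bigr => i _.
    rewrite mxE (bigD1 i)//= big1 ?addr0 => [|j ji].
      have -> := jacobian_test_field dist cphi rad s0 sc i i Ux.
      by rewrite x0 !eqxx mulr1 mulrC.
    have -> := jacobian_test_field dist cphi rad s0 sc j i Ux.
    by rewrite x0 eqxx (negbTE ji) !mulr0.
  rewrite q0 dq wE.
  rewrite [leRHS](_ : _ = phi 0 * (C * S - 2 * K * m%:R * S) / s); last by field.
  rewrite mulr_ge0 ?invr_ge0 ?(ltW s0)// mulr_ge0//.
  have : 0 <= (N%:R * N%:R) * (K * S) by rewrite mulr_ge0.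
  by nra.
have [xr|rx] := ltP `|x| r; last first.
  have rx2 : r / 2 < `|x|.
    by rewrite (lt_le_trans _ rx)// ltr_pdivrMr// mulr_natr mulr2n ltrDl.
  have [pE dpE] := cutoff_far cphi rad s0 sc Ux rx2.
  have -> : \tr (P *m 'J chi x) = 0.
    rewrite /mxtrace big1// => i _; rewrite mxE big1// => j _.
    have -> := jacobian_test_field dist cphi rad s0 sc j i Ux.
    by rewrite (negbTE x0) pE dpE !mul0r addr0 mulr0.
  by rewrite pE dpE oppr0 !mul0r !mulr0 subr0 !addr0.
have [eps epsb ->] := trace_test_field Ux GP x0 xr.
have [[xd _] g0 gb _ _] := est xr x0.
have [/andP[p0 p1] ->] := enorm_normalize_perp PT PP g0.
move: p0 p1; set p := enorm _ ^+ 2 => p0 p1.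
have dx0 : 0 < d x by exact: d_gt0.
set q := d x / s.
have q0 : 0 < q by rewrite divr_gt0.
have -> : d x / s ^+ 2 = q / s by rewrite /q; field.
have [q1|q1] := leP 1 q.
  by have [-> ->] := cutoff_ge1 cphi q1; rewrite oppr0 !mul0r !mulr0 subr0 !addr0 mulr0.
(* Passes from the error at x to the error at scale s: q < 1 gives |x| <= 2 d x <= 2 s, and 2^alpha
   <= 2 because alpha <= 1. *)
have eS : enorm x `^ alpha <= 2 * S.
  have [/andP[a0 a1] _ _ _] := dist.
  have x2s : enorm x <= 2 * s.
    by apply: (le_trans xd); rewrite ler_wpM2l// ltW// -[s]mul1r -ltr_pdivrMr.
  apply: (@le_trans _ _ ((2 * s) `^ alpha)).
    by apply: ge0_ler_powR; rewrite ?nnegrE ?enorm_ge0 ?mulr_ge0 ?(ltW a0) ?(ltW s0).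
  rewrite powRM ?(ltW s0)// -SE ler_wpM2r//.
  by apply: ler1_powR; rewrite ?ler1n.
have e0 : 0 <= enorm x `^ alpha by exact: powR_ge0.
move: gb epsb eS e0; set G := enorm _ ^+ 2; move: (enorm x `^ alpha) => e gb epsb eS e0.
have b0 : 0 <= phi q by apply: (cutoff_ge0 cphi); exact: ltW.
have a0 : derive1 phi q <= 0 by exact: (cutoff_derive1_le0 cphi).
(* Either q < delta and phi' vanishes, or q >= delta >= s and phi' <= 0 decides the sign. *)
have aq : derive1 phi q * (q - s) <= 0.
  have [qd|dq] := ltP `|q| delta; first by rewrite (flat _ qd).2 mul0r.
  rewrite mulr_le0_ge0// subr_ge0 (le_trans sdl)// (le_trans dq)//.
  by rewrite ger0_norm// ltW.
move: b0 a0 aq; move: (phi q) (derive1 phi q) => b a b0 a0 aq.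
rewrite wE.
(* Three nonnegative terms: the passage from q to s in front of p, the tangential part of weight 1 -
   p, and the part proportional to phi(q), where C has to beat the errors. *)
rewrite [leRHS](_ : _ = s^-1 * ((- (a * (q - s))) * p +
    (- a) * q * (1 - p) * (1 - (1 - K * (2 * S)) * G) +
    b * (C * S - K * (2 * S) * m%:R + (1 - K * (2 * S)) * eps))); last by field.
rewrite mulr_ge0 ?invr_ge0 ?(ltW s0)//.
have KE : K * e <= K * (2 * S) by rewrite ler_wpM2l// ltW.
have Ke0 : 0 <= K * e by rewrite mulr_ge0// ltW.
(* Since G <= 1 + 2 K S, the product is at most (1 - 2 K S)(1 + 2 K S) <= 1. *)
have GE : 0 <= 1 - (1 - K * (2 * S)) * G by nra.
rewrite !addr_ge0//.
- by rewrite mulr_ge0// oppr_ge0.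
- apply: mulr_ge0 => //; apply: mulr_ge0; last by rewrite subr_ge0.
  by apply: mulr_ge0; [rewrite oppr_ge0|exact: ltW].
apply: mulr_ge0 => //.
have eps1 : `|eps| <= N%:R * N%:R * (K * (2 * S)).
  by rewrite (le_trans epsb)// mulrA ler_wpM2l.
move: eps1; rewrite ler_norml => /andP[eps1 _].
have : (1 - K * (2 * S)) * (eps + N%:R * N%:R * (K * (2 * S))) >= 0.
  by apply: mulr_ge0; [rewrite subr_ge0|rewrite -lerBlDr sub0r].
have : 0 <= (K * (2 * S)) * (N%:R * N%:R * (K * (2 * S))).
  by rewrite !mulr_ge0 ?(ltW K0).
move: (N%:R * N%:R : R) NN CS => n2 NN CS.
by nra.
Qed.

End monotonicity_integrand.

(** * Integration of the pointwise inequality *)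

Lemma near_fst (T1 T2 : topologicalType) (P : set T1) (z : T1 * T2) :
  (\forall x \near z.1, P x) -> \forall y \near z, P y.1.
Proof.
have c1 : {for z, continuous (fst : T1 * T2 -> T1)} by exact: cvg_fst.
exact: c1.
Qed.

Lemma eq_continuous_at (T S : topologicalType) (f g : T -> S) (x : T) :
  f =1 g -> {for x, continuous f} -> {for x, continuous g}.
Proof. by move=> /funext ->. Qed.

Lemma continuous_at_fst (T1 T2 S : topologicalType) (f : T1 -> S) (z : T1 * T2) :
  {for z.1, continuous f} -> {for z, continuous (fun y => f y.1)}.
Proof.
move=> cf; apply: (@continuous_comp _ _ _ fst f) => //.
exact: cvg_fst.
Qed.

Lemma continuous_at_snd_entry (R : realType) (T : topologicalType) (N : nat)
    (z : T * 'M[R]_N) i j :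
  {for z, continuous (fun y : T * 'M[R]_N => y.2 i j)}.
Proof.
apply: (@continuous_comp _ _ _ snd (fun M : 'M[R]_N => M i j)).
  exact: cvg_snd.
exact: coord_continuous.
Qed.

Lemma continuous_enorm (R : realType) (N : nat) :
  continuous (@enorm R N).
Proof.
move=> x; apply: (@continuous_comp _ _ _ (fun x : 'rV[R]_N => \sum_i x 0 i ^+ 2)).
  apply: continuous_at_sum => i _.
  have cx : {for x, continuous (fun x : 'rV[R]_N => x 0 i)} by exact: coord_continuous.
  apply: (@eq_continuous_at _ _ (fun x : 'rV[R]_N => x 0 i * x 0 i)).
    by move=> y; rewrite expr2.
  exact: (continuousM cx cx).
exact: sqrt_continuous.
Qed.

Section monotonicity.
Variables (R : realType) (N m : nat) (U Gam : set 'rV[R]_N) (alpha : R).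
Variable V : {measure set (RN_Grass R N) -> \bar R}.
Variables (d : 'rV[R]_N -> R) (phi : R -> R) (K r c delta : R).
Hypotheses (oU : open U) (varV : varifold m U V).
Hypothesis statV : stationary_tangent U Gam V.
Hypotheses (dist : distortion Gam alpha d) (cphi : cutoff phi).
Hypothesis rad : adapted_radius U d alpha K r c.
Hypothesis dl0 : 0 < delta.
Hypothesis flat : forall t, `|t| < delta -> phi t = phi 0 /\ derive1 phi t = 0.

Let K0 : 0 < K. Proof. by case: rad. Qed.
Let r0 : 0 < r. Proof. by case: rad. Qed.
Let ballU x : `|x| < r -> U x. Proof. by case: rad => _ _ H _ _ /H[]. Qed.
Let est x : `|x| < r -> x != 0 -> almost_radial d alpha K x.
Proof. by case: rad => _ _ H _ _ /H[]. Qed.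
Let sublevel x : U x -> d x < c -> enorm x < r / 2.
Proof. by case: rad => _ _ _ + _; apply. Qed.
Let d_gt0 x : U x -> x != 0 -> 0 < d x.
Proof. by case: rad => _ _ _ _; apply. Qed.

Let D : set (RN_Grass R N) := U `*` Grass m.
Let B : set 'rV[R]_N := [set x | `|x| <= r / 2].

Let r2r : r / 2 < r.
Proof. by rewrite ltr_pdivrMr// mulr_natr mulr2n ltrDl. Qed.

Let cB : compact B. Proof. exact: compact_norm_le. Qed.

Let BU : B `<=` U.
Proof. by move=> x /= xr; apply: ballU; exact: le_lt_trans r2r. Qed.

Let d_ge0 x : U x -> 0 <= d x.
Proof.
move=> Ux; have [->|x0] := eqVneq x 0; first by rewrite (distortion0 dist).
exact/ltW/d_gt0.
Qed.

Let d_continuous x : x != 0 -> {for x, continuous d}.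
Proof.
move=> x0; have [_ [dC _] _ _] := dist.
by apply: differentiable_continuous; have [] := dC x x0.
Qed.

Let grad_continuous j x : x != 0 -> {for x, continuous (fun y => grad d y 0 j)}.
Proof.
move=> x0; have [_ [_ gC] _ _] := dist.
apply: (@continuous_comp _ _ _ (grad d) (fun v : 'rV[R]_N => v 0 j)).
  by apply: differentiable_continuous; have [] := gC x x0.
exact: coord_continuous.
Qed.

Let near0_flat t : 0 < t -> \forall x \near (0 : 'rV[R]_N),
  phi (d x / t) = phi 0 /\ derive1 phi (d x / t) = 0.
Proof.
move=> t0.
have := distortion_ratio_near0 dist rad t0 dl0.
by apply: filterS => x /flat.
Qed.

Let far t x : 0 < t <= c -> U x -> ~ B x ->
  phi (d x / t) = 0 /\ derive1 phi (d x / t) = 0.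
Proof.
move=> /andP[t0 tc] Ux /negP; rewrite -ltNge => rx.
exact: (cutoff_far cphi rad t0 tc Ux rx).
Qed.

Let ratio_continuous t x : x != 0 -> {for x, continuous (fun y => d y / t)}.
Proof.
move=> x0; have cc : {for x, continuous (fun _ : 'rV[R]_N => t^-1)} by exact: cst_continuous.
exact: (continuousM (d_continuous x0) cc).
Qed.

(** At the origin phi (d / t) is locally constant, so no regularity of d at 0 is required beyond its
    smallness. *)
Lemma cutoff_distance_continuous t x : 0 < t -> U x ->
  {for x, continuous (fun y => phi (d y / t))}.
Proof.
move=> t0 Ux; have [->|x0] := eqVneq x 0.
  apply: (@near_eq_continuous _ _ (cst (phi 0))); last exact: cst_continuous.
  by apply: filterS (near0_flat t0) => y [].
have [dp _] := cutoff_C1 cphi (divr_gt0 (d_gt0 Ux x0) t0).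
have cp : {for d x / t, continuous phi}.
  by apply: differentiable_continuous; move/derivable1_diffP : dp.
exact: (continuous_comp (@ratio_continuous t x x0) cp).
Qed.

Let dphi_continuous t x : 0 < t -> U x ->
  {for x, continuous (fun y => derive1 phi (d y / t))}.
Proof.
move=> t0 Ux; have [->|x0] := eqVneq x 0.
  apply: (@near_eq_continuous _ _ (cst 0)); last exact: cst_continuous.
  by apply: filterS (near0_flat t0) => y [].
have [_ cp] := cutoff_C1 cphi (divr_gt0 (d_gt0 Ux x0) t0).
exact: (continuous_comp (@ratio_continuous t x x0) cp).
Qed.

Lemma integrable_cutoff t : 0 < t <= c ->
  V.-integrable D (EFin \o (fun z : RN_Grass R N => phi (d z.1 / t))).
Proof.
move=> tc; have /andP[t0 _] := tc.
apply: (varifold_integrable oU varV cB BU (f := fun z => phi (d z.1 / t))).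
- by move=> z Uz; exact: (continuous_at_fst (cutoff_distance_continuous t0 Uz)).
- by move=> z Uz Bz; exact: (far tc Uz Bz).1.
Qed.

Lemma integrable_derive_cutoff t : 0 < t <= c -> V.-integrable D (EFin \o
  (fun z : RN_Grass R N => - derive1 phi (d z.1 / t) * (d z.1 / t ^+ 2))).
Proof.
move=> tc; have /andP[t0 _] := tc.
apply: (varifold_integrable oU varV cB BU
  (f := fun z => - derive1 phi (d z.1 / t) * (d z.1 / t ^+ 2))).
- move=> z Uz.
  apply: (@continuous_at_fst _ _ _ (fun x => - derive1 phi (d x / t) * (d x / t ^+ 2))).
  have [z0|z0] := eqVneq z.1 0.
    apply: (@near_eq_continuous _ _ (cst 0)); last exact: cst_continuous.
    by rewrite z0; apply: filterS (near0_flat t0) => y [_ ->]; rewrite oppr0 mul0r.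
  have c1 : {for z.1, continuous (fun x => - derive1 phi (d x / t))}.
    exact: (continuousN (dphi_continuous t0 Uz)).
  exact: (continuousM c1 (@ratio_continuous (t ^+ 2) z.1 z0)).
- by move=> z Uz Bz; rewrite (far tc Uz Bz).2 oppr0 mul0r.
Qed.

(** The normalized gradient is under control only for 0 < |x| < r, where [almost_radial] keeps the
    gradient from vanishing. Near 0 and near the remaining points of U the factor phi' is
    identically zero. *)
Lemma integrable_perp t : 0 < t <= c -> V.-integrable D (EFin \o
  (fun z : RN_Grass R N => derive1 phi (d z.1 / t) *
     enorm (((enorm (grad d z.1))^-1 *: grad d z.1) *m (1%:M - z.2)) ^+ 2)).
Proof.
move=> tc; have /andP[t0 _] := tc.
apply: (varifold_integrable oU varV cB BU (f := fun z => derive1 phi (d z.1 / t) *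
     enorm (((enorm (grad d z.1))^-1 *: grad d z.1) *m (1%:M - z.2)) ^+ 2)); last first.
  by move=> z Uz Bz; rewrite (far tc Uz Bz).2 mul0r.
move=> z Uz; have [z0|z0] := eqVneq z.1 0.
  apply: (@near_eq_continuous _ _ (cst 0)); last exact: cst_continuous.
  have := near0_flat t0; rewrite -z0 => /near_fst.
  by apply: filterS => y [_ /= ->]; rewrite mul0r.
have [zr|rz] := ltP `|z.1| r; last first.
  have far1 : \forall x \near z.1, derive1 phi (d x / t) = 0.
    have rx2 : r / 2 < `|z.1| by exact: lt_le_trans rz.
    have Unbhs : nbhs z.1 U by exact: open_nbhs_nbhs.
    apply: filterS2 Unbhs (near_norm_gt rx2) => x Ux rx.
    by apply: (far tc Ux _).2; apply/negP; rewrite -ltNge.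
  apply: (@near_eq_continuous _ _ (cst 0)); last exact: cst_continuous.
  by apply: filterS (near_fst far1) => y /= ->; rewrite mul0r.
have [_ g0 _ _ _] := est zr z0.
have cg : {for z.1, continuous (grad d)}.
  have [_ [_ gC] _ _] := dist.
  by apply: differentiable_continuous; have [] := gC z.1 z0.
have cn : {for z, continuous (fun y : 'rV[R]_N * 'M[R]_N => (enorm (grad d y.1))^-1)}.
  apply: (@continuous_at_fst _ _ _ (fun x => (enorm (grad d x))^-1)).
  apply: (@continuousV _ _ (fun x => enorm (grad d x))); first by rewrite enorm_eq0.
  exact: (continuous_comp cg (@continuous_enorm R N (grad d z.1))).
have ce j : {for z, continuous (fun y : 'rV[R]_N * 'M[R]_N =>
    \sum_k (enorm (grad d y.1))^-1 * grad d y.1 0 k * ((k == j)%:R - y.2 k j))}.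
  apply: continuous_at_sum => k _.
  have c1 : {for z, continuous (fun y : 'rV[R]_N * 'M[R]_N => grad d y.1 0 k)}.
    exact: (continuous_at_fst (@grad_continuous k z.1 z0)).
  have c2 : {for z, continuous (fun y : 'rV[R]_N * 'M[R]_N => (k == j)%:R - y.2 k j)}.
    have c3 : {for z, continuous (fun _ : 'rV[R]_N * 'M[R]_N => (k == j)%:R : R)}.
      exact: cst_continuous.
    exact: (continuousB c3 (@continuous_at_snd_entry _ _ _ z k j)).
  exact: (continuousM (continuousM cn c1) c2).
have cp : {for z, continuous (fun y : 'rV[R]_N * 'M[R]_N =>
    enorm (((enorm (grad d y.1))^-1 *: grad d y.1) *m (1%:M - y.2)) ^+ 2)}.
  apply: (@eq_continuous_at _ _ (fun y : 'rV[R]_N * 'M[R]_N =>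
    \sum_j (\sum_k (enorm (grad d y.1))^-1 * grad d y.1 0 k * ((k == j)%:R - y.2 k j)) *
      (\sum_k (enorm (grad d y.1))^-1 * grad d y.1 0 k * ((k == j)%:R - y.2 k j)))).
    move=> y; rewrite enorm_sqr; apply: eq_bigr => j _.
    rewrite -expr2 [in RHS]mxE; congr (_ ^+ 2); apply: eq_bigr => k _.
    rewrite [in RHS]mxE; congr (_ * _).
    by rewrite !mxE.
  by apply: continuous_at_sum => j _; exact: (continuousM (ce j) (ce j)).
exact: (continuousM (continuous_at_fst (dphi_continuous t0 Uz)) cp).
Qed.

(** [C1_on] speaks of directional derivatives, so the Jacobian is expanded in them. Continuity over
    the whole space, not just over U, is what the passage to [first_variation] requires. *)
Let trace_continuous s : 0 < s <= c -> continuous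
  (fun z : 'rV[R]_N * 'M[R]_N => \tr (z.2 *m 'J (test_field phi d r s) z.1)).
Proof.
move=> /andP[s0 sc] z.
have C1 := test_field_C1 dist cphi rad s0 sc.
apply: (@eq_continuous_at _ _ (fun z : 'rV[R]_N * 'M[R]_N =>
   \sum_i \sum_j z.2 i j * ('D_(delta_mx 0 j) (test_field phi d r s) z.1) 0 i)).
  move=> y; rewrite /mxtrace; apply: eq_bigr => i _.
  rewrite [in RHS]mxE; apply: eq_bigr => j _; congr (_ * _).
  have [df _] := C1 y.1 I.
  by rewrite (deriveEjacobian (delta_mx 0 j) df) -rowE mxE.
apply: continuous_at_sum => i _; apply: continuous_at_sum => j _.
have c1 : {for z, continuous (fun y : 'rV[R]_N * 'M[R]_N =>
    ('D_(delta_mx 0 j) (test_field phi d r s) y.1) 0 i)}.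
  apply: (@continuous_at_fst _ _ _
    (fun x => ('D_(delta_mx 0 j) (test_field phi d r s) x) 0 i)).
  apply: (@continuous_comp _ _ _ ('D_(delta_mx 0 j) (test_field phi d r s))
    (fun v : 'rV[R]_N => v 0 i)); first by have [_] := C1 z.1 I; exact.
  exact: coord_continuous.
exact: (continuousM (@continuous_at_snd_entry _ _ _ z i j) c1).
Qed.

Let trace_far s z : 0 < s <= c -> U z.1 -> ~ B z.1 ->
  \tr (z.2 *m 'J (test_field phi d r s) z.1) = 0.
Proof.
move=> sc Uz Bz; have /andP[s0 sc'] := sc.
rewrite /mxtrace big1// => i _; rewrite mxE big1// => j _.
rewrite (jacobian_test_field dist cphi rad s0 sc' j i Uz).
case: eqVneq => [z0|_]; last by have [-> ->] := far sc Uz Bz; rewrite !mul0r addr0 mulr0.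
by exfalso; apply: Bz; rewrite /B/= z0 normr0 divr_ge0// ltW.
Qed.

Lemma integrable_trace s : 0 < s <= c -> V.-integrable D (EFin \o
  (fun z : RN_Grass R N => \tr (z.2 *m 'J (test_field phi d r s) z.1))).
Proof.
move=> sc; apply: (varifold_integrable oU varV cB BU
  (f := fun z => \tr (z.2 *m 'J (test_field phi d r s) z.1))).
- by move=> z _; exact: trace_continuous.
- by move=> z Uz Bz; exact: trace_far.
Qed.

(** Stationarity enters here, through the C^1 regularity, compact support and tangency of the test
    field. *)
Lemma integral_trace_test_field s : 0 < s <= c ->
  \int[V]_(z in D) \tr (z.2 *m 'J (test_field phi d r s) z.1) = 0.
Proof.
move=> sc; have /andP[s0 sc'] := sc.
rewrite -(varifold_Rintegral_setT oU varV cB BU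
  (f := fun z => \tr (z.2 *m 'J (test_field phi d r s) z.1)) (trace_continuous sc)).
  apply: statV.
    exact: (test_field_C1c dist cphi rad s0 sc').
  exact: (test_field_tangent phi r s dist).
by move=> z Uz Bz; exact: trace_far.
Qed.

Let derive_ratio x t : U x -> 0 < t ->
  derivable (fun u : R => phi (d x / u)) t 1 /\
  derive1 (fun u : R => phi (d x / u)) t =
    - derive1 phi (d x / t) * (d x / t ^+ 2).
Proof.
move=> Ux t0; have tN : t != 0 by rewrite gt_eqF.
have [x0|x0] := eqVneq x 0.
  rewrite x0 (distortion0 dist) [X in _ * X]mul0r mulr0.
  rewrite (_ : (fun u : R => _) = cst (phi 0)).
    by split; [exact: derivable_cst|exact: derive1_cst].
  by apply/funext => u; rewrite mul0r.
have [dp _] := cutoff_C1 cphi (divr_gt0 (d_gt0 Ux x0) t0).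
have did : derivable (id : R -> R) t 1 by exact: derivable_id.
have dV : derivable (fun u : R => u^-1) t 1 by exact: (derivableV tN did).
have DV : 'D_1 (fun u : R => u^-1) t = - t ^- 2.
  by rewrite (deriveV tN did) derive_id /GRing.scale/= mulr1.
have dc : derivable (cst (d x) : R -> R) t 1 by exact: derivable_cst.
have dq : derivable (fun u : R => d x / u) t 1.
  exact: (derivableM dc dV).
have Dq : derive1 (fun u : R => d x / u) t = - (d x / t ^+ 2).
  by rewrite derive1E (deriveM dc dV) derive_cst scaler0 addr0 DV /GRing.scale/= mulrN.
split; last by rewrite mulNr -mulrN -Dq; exact: (derive1_comp dq dp).
move/derivable1_diffP : dq => dq; move/derivable1_diffP : dp => dp.
by apply/derivable1_diffP; exact: (differentiable_comp dq dp).
Qed.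

(** The domination is carried out for t in (s / 2, c): a positive lower bound controls 1 / t, and t
    < c keeps all supports in the same ball [B]. *)
Lemma derive_integral_cutoff s : 0 < s < c ->
  let I t := \int[V]_(z in D) phi (d z.1 / t) in
  derivable I s 1 /\ derive1 I s =
    \int[V]_(z in D) (- derive1 phi (d z.1 / s) * (d z.1 / s ^+ 2)).
Proof.
move=> /andP[s0 sc] /=.
have [M M0 pM] := cutoff_derive1_bounded cphi.
pose f t (z : RN_Grass R N) := phi (d z.1 / t).
have mD : measurable D := measurable_varifold_domain m oU.
have Is : [set` `]s / 2, c[] s.
  by rewrite /= in_itv/= sc andbT ltr_pdivrMr// mulr_natr mulr2n ltrDl.
have Igt0 t : [set` `]s / 2, c[] t -> 0 < t <= c.
  rewrite /= in_itv/= => /andP[st tc]; rewrite (ltW tc) andbT.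
  by rewrite (lt_trans _ st)// divr_gt0.
have intf t : [set` `]s / 2, c[] t -> V.-integrable D (EFin \o f t).
  by move=> /Igt0 tc; exact: integrable_cutoff.
have df t z : [set` `]s / 2, c[] t -> D z -> derivable (f ^~ z) t 1.
  by move=> /Igt0/andP[t0 _] [Uz _]; exact: (derive_ratio Uz t0).1.
(* The t-derivative is - phi'(q) q / t with q = d / t. It vanishes unless q < 1, so it is at most M
   / t <= 2 M / s, and it is zero off [B]. *)
pose G (z : RN_Grass R N) : R := (M * (2 / s)) * \1_B (z.1 : 'rV[R]_N).
have G0 z : 0 <= G z by rewrite /G !mulr_ge0 ?invr_ge0 ?(ltW s0).
have intG : V.-integrable D (EFin \o G).
  exact: (varifold_integrable_cst oU varV _ cB BU).
have Gb t z : [set` `]s / 2, c[] t -> D z -> `|partial1of2 f t z| <= G z.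
  move=> It [Uz _]; have tc := Igt0 _ It; have /andP[t0 tc'] := tc.
  rewrite /partial1of2 (derive_ratio Uz t0).2 /G indicE.
  have [/set_mem Bz|/negP nBz] := boolP ((z.1 : 'rV[R]_N) \in B); last first.
    have nB : ~ B z.1 by move=> Bz; apply: nBz; exact: mem_set.
    by rewrite (far tc Uz nB).2 oppr0 mul0r normr0 mulr0.
  rewrite mulr1.
  have q0 : 0 <= d z.1 / t by rewrite divr_ge0 ?d_ge0// ltW.
  have [q1|q1] := leP 1 (d z.1 / t).
    rewrite (cutoff_ge1 cphi q1).2 oppr0 mul0r normr0.
    by rewrite !mulr_ge0 ?invr_ge0 ?(ltW s0).
  apply: ler_normM; first by rewrite normrN; exact: pM.
  rewrite (_ : d z.1 / t ^+ 2 = d z.1 / t * t^-1); last by field; rewrite gt_eqF.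
  rewrite ger0_norm; last by apply: mulr_ge0 => //; rewrite invr_ge0 ltW.
  apply: (@le_trans _ _ (1 * t^-1)).
    by rewrite ler_wpM2r ?invr_ge0 ?(ltW t0)// ltW.
  rewrite mul1r -[2 / s]invrK invf_div lef_pV2 ?posrE ?divr_gt0//.
  by move: It; rewrite /= in_itv/= => /andP[/ltW].
split; first exact: (derivable_under_integral mD Is intf df G0 intG Gb).
rewrite (differentiation_under_integral mD Is intf df G0 intG Gb).
apply: eq_Rintegral => z /set_mem [Uz _].
exact: (derive_ratio Uz s0).2.
Qed.

End monotonicity.

(** * Derivatives of the weight factors and the conclusion *)

Lemma is_derive1_exprV (R : realType) (m : nat) (s : R) : s != 0 ->
  is_derive s 1 (fun t : R => t ^- m) (- (m%:R / s) * s ^- m).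
Proof.
move=> s0.
have dX : derivable (fun t : R => t ^+ m) s 1 by exact: exprn_derivable.
have sm : s ^+ m != 0 by rewrite expf_neq0.
have dV : derivable (fun t : R => t ^- m) s 1.
  exact: (@derivableV _ _ (fun t : R => t ^+ m) s 1 sm dX).
split; first exact: dV.
rewrite (@deriveV _ _ (fun t : R => t ^+ m) s 1 sm dX) exp_derive /GRing.scale/= mulr1.
(* The power rule produces the exponent [m.-1], which is m - 1 only for m > 0; for m = 0 both sides
   are zero. *)
case: m sm {dX dV} => [|m] sm; first by rewrite !mul0r mulr0 oppr0 mul0r.
have sm' : s ^+ m != 0 by rewrite expf_neq0.
rewrite /= [s ^+ m.+1]exprS; move: sm'; move: (s ^+ m) => y y0.
by field; rewrite s0 y0.
Qed.

Lemma is_derive1_expR_powR (R : realType) (C a s : R) : 0 < s ->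
  is_derive s 1 (fun t : R => expR (C * t `^ a))
    (expR (C * s `^ a) * (C * a * s `^ (a - 1))).
Proof.
move=> s0; have [dp pE] := is_derive1_powR a s0.
have dc : derivable (cst C : R -> R) s 1 by exact: derivable_cst.
have df : derivable (fun t : R => C * t `^ a) s 1 by exact: (derivableM dc dp).
have fE : 'D_1 (fun t : R => C * t `^ a) s = C * (a * s `^ (a - 1)).
  by rewrite (deriveM dc dp) pE derive_cst scaler0 addr0.
have [dexp eE] := is_derive_expR (C * s `^ a).
have dd : differentiable (fun t : R => C * t `^ a) s by move/derivable1_diffP : df.
have de : differentiable (@expR R) (C * s `^ a) by move/derivable1_diffP : dexp.
apply: DeriveDef; first exact: (diff_derivable (differentiable_comp dd de)).
by rewrite (derive_comp1 (1 : R) dd dexp) fE derive1E eE !mulrA.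
Qed.

Theorem theorem4p4 (R : realType) (m n k : nat) (U Gam : set 'rV[R]_(m + n))
    (V : {measure set (RN_Grass R (m + n)) -> \bar R})
    (alpha : R) (d : 'rV[R]_(m + n) -> R) (phi : R -> R) :
  open U ->
  C1_submanifold k U Gam -> Gam 0 ->
  varifold m U V -> stationary_tangent U Gam V ->
  distortion Gam alpha d -> sublevels_shrink U d ->
  cutoff phi ->
  exists C rho : R, [/\ 0 < C, 0 < rho &
    forall s : R, 0 < s < rho ->
      let F (t : R) := expR (C * t `^ alpha) * t ^- m *
                       \int[weight V]_(x in U) phi (d x / t) in
      derivable F s 1 /\
      - (expR (C * s `^ alpha) * s ^- m *
         \int[V]_(z in U `*` Grass m)
           (derive1 phi (d z.1 / s) *
            enorm (((enorm (grad d z.1))^-1 *: grad d z.1) *m (1%:M - z.2)) ^+ 2))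
      <= derive1 F s].
Proof.
move=> oU [_ GU _] G0 varV statV dist shrink cphi.
have [/andP[a0 a1] _ _ _] := dist.
have [K K0 estn] := distortion_estimates dist.
have [r r0 rP] : exists2 r, 0 < r & forall x : 'rV[R]_(m + n), `|x| < r ->
    U x /\ (x != 0 -> almost_radial d alpha K x).
  have Un : \forall x \near (0 : 'rV[R]_(m + n)), U x.
    by apply: open_nbhs_nbhs; split => //; exact: GU.
  have := filterI Un estn => /(_ (nbhs_filter _))/nbhs_ballP[r /= r0 rP].
  exists r => // x xr; apply: rP; rewrite -ball_normE /ball_/= sub0r normrN//.
have r20 : 0 < r / 2 by rewrite divr_gt0.
have [c c0 sublevel] := shrink _ r20.
(* Apply the shrinking property with radius |x| itself: d x below the resulting level would give |x|
   < |x|. *)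
have d_gt0 x : U x -> x != 0 -> 0 < d x.
  move=> Ux; rewrite -enorm_gt0 => /shrink[c' c'0 /(_ x Ux)].
  by move=> H; rewrite (lt_le_trans c'0)// leNgt; apply/negP => /H; rewrite ltxx.
have rad : adapted_radius U d alpha K r c by [].
have [delta /andP[dl0 dl1] flat] := cutoff_flat cphi.
have K20 : 0 < (2 * K)^-1 by rewrite invr_gt0 mulr_gt0.
have [rho rho0 rhoP] := powR_lt_near0 a0 K20.
set N := (m + n)%N in U Gam V d oU GU G0 varV statV dist shrink estn rP sublevel d_gt0 rad *.
(* The constant demanded by [integrand_ge0], plus 1 so that it is positive even in dimension zero.
   The exponent carries C' / alpha because differentiating s^alpha returns a factor alpha. *)
pose C' := 2 * K * (m%:R + N%:R * N%:R) + 1.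
have C'0 : 0 < C'.
  by rewrite ltr_wpDl// mulr_ge0 ?addr_ge0 ?mulr_ge0 ?(ltW K0).
exists (C' / alpha), (Num.min (Num.min c delta) rho); split.
- by rewrite divr_gt0.
- by rewrite !lt_min c0 dl0 rho0.
move=> s /andP[s0]; rewrite !lt_min => /andP[/andP[sc sdl] srho] F.
have sc' : 0 < s <= c by rewrite s0 ltW.
have scc : 0 < s < c by rewrite s0.
have sN : s != 0 by rewrite gt_eqF.
have sa : s `^ alpha < (2 * K)^-1 by apply: rhoP; rewrite (ltW s0).
pose D : set (RN_Grass R N) := U `*` Grass m.
have mD : measurable D := measurable_varifold_domain m oU.
pose I t := \int[V]_(z in D) phi (d z.1 / t).
have [dI DI] := derive_integral_cutoff oU varV dist cphi rad dl0 flat scc.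
have phic t x : 0 < t -> U x -> {for x, continuous (fun y => phi (d y / t))}.
  exact: (cutoff_distance_continuous dist cphi rad dl0 flat).
(* Only t near s, hence positive, is considered: for negative t the argument of phi may be negative
   and the integrand need not be nonnegative. *)
have WI : {near s, I =1 (fun t => \int[weight V]_(x in U) phi (d x / t))}.
  apply: filterS (lt_nbhsr s0) => t t0.
  rewrite (weight_Rintegral oU varV (f := fun x => phi (d x / t)))//.
    by move=> x Ux; exact: phic.
  move=> x Ux; apply: (cutoff_ge0 cphi); rewrite divr_ge0 ?(ltW t0)//.
  have [->|x0] := eqVneq x 0; first by rewrite (distortion0 dist).
  exact/ltW/d_gt0.
have iI : is_derive s 1 (fun t => \int[weight V]_(x in U) phi (d x / t))
    (\int[V]_(z in D) (- derive1 phi (d z.1 / s) * (d z.1 / s ^+ 2))).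
  apply: (near_eq_is_derive WI).
  exact: (DeriveDef dI (etrans (esym (derive1E _ _)) DI)).
have [dE EE] := is_derive1_expR_powR (C' / alpha) alpha s0.
have [dP PE] := is_derive1_exprV m sN.
have [dW WE] := iI.
have dEP := derivableM dE dP.
have dF : derivable F s 1 by exact: (derivableM dEP dW).
split; first exact: dF.
rewrite derive1E (deriveM dEP dW) (deriveM dE dP) EE PE WE.
rewrite -(nbhs_singleton WI).
set w := s `^ (alpha - 1); set S := s `^ alpha.
have sw : s * w = S by rewrite /w /S mulr_powRB1// ltW.
have i1 := integrable_cutoff oU varV dist cphi rad dl0 flat sc'.
have i2 := integrable_derive_cutoff oU varV dist cphi rad dl0 flat sc'.
have i3 := integrable_perp oU varV dist cphi rad dl0 flat sc'.
have i4 := integrable_trace oU varV dist cphi rad sc'.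
have z4 := integral_trace_test_field oU varV statV dist cphi rad sc'.
set E := expR _.
have E0 : 0 < E by exact: expR_gt0.
have S1 : K * (2 * S) <= 1.
  by rewrite mulrCA mulrA mulrC -ler_pdivlMr ?mulr_gt0// div1r ltW.
pose lam := (1 - K * (2 * S)) / s.
(* [- mu] is the logarithmic derivative of the weight [E * s ^- m]. *)
pose mu := m%:R / s - C' * w.
pose f1 (z : RN_Grass R N) := phi (d z.1 / s).
pose f2 (z : RN_Grass R N) := - derive1 phi (d z.1 / s) * (d z.1 / s ^+ 2).
pose f3 (z : RN_Grass R N) := derive1 phi (d z.1 / s) *
  enorm (((enorm (grad d z.1))^-1 *: grad d z.1) *m (1%:M - z.2)) ^+ 2.
pose f4 (z : RN_Grass R N) := \tr (z.2 *m 'J (test_field phi d r s) z.1).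
have pos : 0 <= \int[V]_(z in D) (f2 z + f3 z - mu * f1 z + lam * f4 z).
  apply: Rintegral_ge0 => z [Uz Gz].
  apply: (integrand_ge0 dist cphi rad s0 (ltW sc) flat dl0 (ltW sdl)
     erefl sw S1 _ Uz Gz).
  by rewrite /C' lerDl.
(* The multiple of [f4] integrates to zero. What is left, multiplied by [E * s ^- m], is the
   difference of the two sides of the goal. *)
have {}pos : 0 <= \int[V]_(z in D) f2 z + \int[V]_(z in D) f3 z - mu * I s.
  have j1 : V.-integrable D (EFin \o (fun z => mu * f1 z)).
    exact: (integrableZl mD mu i1).
  have j4 : V.-integrable D (EFin \o (fun z => lam * f4 z)).
    exact: (integrableZl mD lam i4).
  have j23 : V.-integrable D (EFin \o (fun z => f2 z + f3 z)).
    exact: (integrableD mD i2 i3).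
  have j231 : V.-integrable D (EFin \o (fun z => f2 z + f3 z - mu * f1 z)).
    exact: (integrableB mD j23 j1).
  move: pos; rewrite (RintegralD mD j231 j4) (RintegralB mD j23 j1).
  rewrite (RintegralD mD i2 i3) (RintegralZl lam mD i4) (RintegralZl mu mD i1).
  by rewrite z4 mulr0 addr0.
move: pos; set A := \int[V]_(z in D) f2 z; set P := \int[V]_(z in D) f3 z => pos.
have sm0 : 0 < s ^- m by rewrite invr_gt0 exprn_gt0.
rewrite -subr_ge0 /GRing.scale/= -/P -/A -/(I s).
rewrite [leRHS](_ : _ = E * s ^- m * (A + P - mu * I s)); last first.
  rewrite /mu -[X in X * A]/(E * s ^- m).
  have smN : s ^+ m != 0 by rewrite expf_neq0.
  have aN : alpha != 0 by rewrite gt_eqF.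
  move: smN {pos}; move: (s ^+ m) (I s) => y J y0.
  by field; rewrite sN y0 aN.
by rewrite mulr_ge0// mulr_ge0// ltW.
Qed.
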